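(* Let $A$ be an $n\times n$ integer matrix all of whose eigenvalues have modulus $>1$, let $m=|\det A|$, let $D=\{d_1,\ldots,d_m\}\subset\mathbb{Z}^n$ be a coset transversal for $\mathbb{Z}^n/A(\mathbb{Z}^n)$, and let $T=T(A,D)\subset\mathbb{R}^n$ be the integral self-affine tile, i.e. the unique nonempty compact set satisfying $A(T)=\bigcup_{d\in D}(T+d)$. Then the Lebesgue measure of $T$ is equal to the measure number $\mathrm{meas}(\mathcal{N})$ of the nucleus $\mathcal{N}$ of the associated self-similar action $(\mathbb{Z}^n,X^* )$, $X=\{x_1,\ldots,x_m\}$.
   Context: The associated self-similar action $(\mathbb{Z}^n,X^* )$ (defined by the virtual endomorphism $A^{-1}:A(\mathbb{Z}^n)\to\mathbb{Z}^n$, the transversal $D$ and the trivial cocycle) is the action of $\mathbb{Z}^n$ (written additively) on the set $X^*$ of finite words over $X$ determined recursively by $g(x_iw)=x_j\,(g|_{x_i})(w)$ for $g\in\mathbb{Z}^n$, $w\in X^*$, where $j$ is the unique index with $g+d_i-d_j\in A(\mathbb{Z}^n)$ and $g|_{x_i}=A^{-1}(g+d_i-d_j)$. For a word put $g|_{x_{i_1}\ldots x_{i_k}}=g|_{x_{i_1}}|_{x_{i_2}}\cdots|_{x_{i_k}}$. The action is contracting: there is a finite set $\mathcal{N}\subset\mathbb{Z}^n$ such that for every $g$ there is $k$ with $g|_v\in\mathcal{N}$ for all words $v$ of length $\ge k$; the smallest such set $\mathcal{N}$ is the nucleus. Regard $\mathcal{N}$ as a directed graph with vertex set $\mathcal{N}$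 and an edge from $g$ to $g|_x$ labeled by $x$ for each $g\in\mathcal{N}$, $x\in X$. For $g\in\mathcal{N}$ let $F_g$ be the set of left-infinite sequences $\ldots z_2z_1$ over $X$ for which there is a left-infinite path $\ldots e_2e_1$ in this graph ending in $g$ with $e_i$ labeled by $z_i$ for all $i$. The measure number is $\mathrm{meas}(\mathcal{N})=\sum_{g\in\mathcal{N}}\mu_u(F_g)$, where $\mu_u$ is the uniform Bernoulli measure (each letter has weight $1/m$) on the space of left-infinite sequences over $X$. *)

(* Defs.v *)
(* R is an abstract realType of MathComp-Analysis; C is R[i] = [complex R]. *)
From HB Require Import structures.
From mathcomp Require Import all_boot all_order all_algebra complex.
From mathcomp Require Import all_classical all_reals all_analysis.

Set Implicit Arguments.
Unset Strict Implicit.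
Unset Printing Implicit Defensive.

Import Order.TTheory GRing.Theory Num.Theory.
Import numFieldNormedType.Exports.

Local Open Scope classical_set_scope.
Local Open Scope ring_scope.

(** ** Expanding integer matrices, digit sets and self-affine tiles *)

(* Vectors are columns, so that [A] acts by [A *m v]. *)
Definition expanding (R : realType) n (A : 'M[int]_n) : Prop :=
  forall z : R[i], eigenvalue (map_mx intr A) z -> 1 < `|z|.

Definition lattice_image n (A : 'M[int]_n) : set 'cV[int]_n := range (mulmx A).

Definition coset_transversal n m (A : 'M[int]_n) (d : 'I_m -> 'cV[int]_n) : Prop :=
  forall v, exists! i, lattice_image A (v - d i).

Definition self_affine_tile (R : realType) n m (A : 'M[int]_n)
    (d : 'I_m -> 'cV[int]_n) (T : set 'cV[R]_n) : Prop :=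
  [/\ T !=set0, compact T &
      [set map_mx intr A *m t | t in T] =
      \bigcup_(i : 'I_m) [set t + map_mx intr (d i) | t in T]].

(** ** The self-similar action of Z^n on words over X = 'I_m *)

Section self_similar_action.
Variables (n m : nat) (A : 'M[int]_n) (d : 'I_m -> 'cV[int]_n).
Implicit Types (g : 'cV[int]_n) (i : 'I_m) (w : seq 'I_m).

(* The defaults of [xget] are never reached when [A] is injective and [d] is a
   transversal. *)
Definition virtual_endo g : 'cV[int]_n := xget 0 [set u | A *m u = g].

Definition act_letter g i : 'I_m :=
  xget i [set j | lattice_image A (g + d i - d j)].

Definition restr_letter g i : 'cV[int]_n :=
  virtual_endo (g + d i - d (act_letter g i)).

Fixpoint act_word g w : seq 'I_m :=
  if w is i :: w' then act_letter g i :: act_word (restr_letter g i) w'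
  else [::].

Definition restr_word g w : 'cV[int]_n := foldl restr_letter g w.

Lemma act_word_cat g v w :
  act_word g (v ++ w) = act_word g v ++ act_word (restr_word g v) w.
Proof. by elim: v g => //= i v IHv g; rewrite IHv. Qed.

Definition contracting_set (N : set 'cV[int]_n) : Prop :=
  finite_set N /\
  forall g, exists k, forall v : seq 'I_m, (k <= size v)%N -> N (restr_word g v).

(* The intersection of all contracting sets: it is contracting as soon as some
   set is ([nucleus_contracting]), hence is then the least contracting set. *)
Definition nucleus : set 'cV[int]_n := smallest contracting_set set0.

Lemma nucleus_unique N : contracting_set N ->
  (forall N', contracting_set N' -> N `<=` N') -> nucleus = N.
Proof.
move=> cN minN; apply/seteqP; split; first exact: smallest_sub.
by move=> g Ng N' [cN' _]; exact: minN Ng.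
Qed.

Lemma contracting_setI N N' :
  contracting_set N -> contracting_set N' -> contracting_set (N `&` N').
Proof.
move=> [fN cN] [_ cN']; split; first exact: finite_setIl.
move=> g; have [[k kN] [k' kN']] := (cN g, cN' g).
exists (maxn k k') => v; rewrite geq_max => /andP[kv k'v].
by split; [exact: kN|exact: kN'].
Qed.

Lemma nucleus_contracting :
  (exists N, contracting_set N) -> contracting_set nucleus.
Proof.
move=> [N0 cN0].
have [S SN0] : exists s : seq 'cV[int]_n, N0 = [set` s].
  by apply/finite_seqP; case: cN0.
have [N cN subN] : exists2 N, contracting_set N & forall g, g \in S ->
    ~ nucleus g -> ~ N g.
  elim: S {SN0} => [|h s [N cN subN]]; first by exists N0.
  have [nh|nh] := pselect (nucleus h).
    by exists N => // g; rewrite inE => /orP[/eqP->//|]; exact: subN.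
  have [N' cN' N'h] : exists2 N', contracting_set N' & ~ N' h.
    apply: contrapT => H; apply: nh => N' [cN' _].
    by apply: contrapT => N'h; apply: H; exists N'.
  exists (N `&` N'); first exact: contracting_setI.
  move=> g; rewrite inE => /orP[/eqP->{g} _ []//|gs ng [Ng _]].
  exact: subN ng Ng.
suff -> : nucleus = N0 `&` N by exact: contracting_setI.
apply/seteqP; split=> [g ng|g [N0g Ng]].
  by split; exact: (ng _ (conj _ (@sub0set _ _))).
have [//|ng] := pselect (nucleus g); exfalso; apply: subN ng Ng.
by move: N0g; rewrite SN0.
Qed.

(* A left-infinite sequence ... z_2 z_1 is the function k |-> z_(k+1), and a
   left-infinite path ... e_2 e_1 ending in [g] is the function [h] of its
   vertices, e_(k+1) being the edge from [h k.+1] to [h k], so that h 0 = g. *)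
Definition path_language (N : set 'cV[int]_n) g : set (nat -> 'I_m) :=
  [set z | exists h : nat -> 'cV[int]_n,
    [/\ h 0%N = g, forall k, N (h k) &
        forall k, restr_letter (h k.+1) (z k) = h k]].

End self_similar_action.

(** ** The uniform Bernoulli measure *)

(* Measurable spaces are pointed in the library, hence alphabets 'I_m.+1. *)
HB.instance Definition _ m := isPointed.Build 'I_m.+1 ord0.

Definition cylinder (X : Type) (w : seq X) : set (nat -> X) :=
  [set z | mkseq z (size w) = w].

Definition infinite_words m : measurableType _ :=
  g_sigma_algebraType (range (@cylinder 'I_m.+1)).

Definition uniform_bernoulli (R : realType) m
    (mu : probability (infinite_words m) R) : Prop :=
  forall w : seq 'I_m.+1, mu (cylinder w) = ((m.+1%:R^-1) ^+ size w)%:E.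

(* Existence of the uniform Bernoulli measure: it is the law of the base-m.+1
   digits of a uniformly distributed point of [0, 1[. *)
Section uniform_bernoulli_exists.
Variables (R : realType) (m : nat).
Local Notation M := m.+1.
Local Notation U01 := (`[0, 1[%classic : set (measurableTypeR R)).

Let q (x : R) k : nat := Num.truncn (M%:R ^+ k * x).
Let digits (x : R) k : 'I_M := inord (q x k.+1 %% M).
Let code (w : seq 'I_M) : nat := foldl (fun v (i : 'I_M) => v * M + i)%N 0%N w.

Let M_gt0 k : 0 < M%:R ^+ k :> R.
Proof. by rewrite exprn_gt0// ltr0n. Qed.

Let q_divn x k : 0 <= x -> (q x k.+1 %/ M)%N = q x k.
Proof.
move=> x0; have y0 : 0 <= M%:R ^+ k * x by rewrite mulr_ge0// ltW.
have z0 : 0 <= M%:R ^+ k.+1 * x by rewrite mulr_ge0// ltW.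
have /andP[qy yq] := truncn_itv y0.
apply/eqP; rewrite eqn_leq -ltnS ltn_divLR// leq_divRL//.
rewrite truncn_lt_nat// truncn_ge_nat// exprS -mulrA !natrM.
by rewrite ![_ * M%:R]mulrC ler_pM2l ?ltr0n// ltr_pM2l ?ltr0n// qy yq.
Qed.

Let cylinder_digits x w : 0 <= x < 1 ->
  cylinder w (digits x) <-> q x (size w) = code w.
Proof.
case/andP=> x0 x1; elim/last_ind: w => [|w i IHw].
  split=> // _; rewrite /q expr0 mul1r; apply/eqP.
  by rewrite -leqn0 truncn_le_nat.
rewrite /cylinder /= size_rcons mkseqS /code foldl_rcons -/(code w).
split=> [/eqP|qE].
  rewrite eqseq_rcons => /andP[/eqP/IHw <- /eqP <-].
  by rewrite /digits inordK ?ltn_mod// -(@q_divn x (size w) x0) -divn_eq.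
have qw : q x (size w) = code w.
  by rewrite -(@q_divn x (size w) x0) qE divnMDl// divn_small// addn0.
congr rcons; first exact/IHw.
by apply/val_inj; rewrite /digits /= inordK ?ltn_mod// qE modnMDl modn_small.
Qed.

Let code_lt w : (code w < M ^ size w)%N.
Proof.
elim/last_ind: w => [//|w i IHw].
rewrite /code foldl_rcons -/(code w) size_rcons expnSr.
apply: (@leq_trans ((code w).+1 * M)); last by rewrite leq_mul2r IHw orbT.
by rewrite mulSnr -addnS leq_add2l.
Qed.

Let Icode w : set (measurableTypeR R) :=
  `[(code w)%:R / M%:R ^+ size w, (code w).+1%:R / M%:R ^+ size w[%classic.

Let sub_Icode w : Icode w `<=` U01.
Proof.
move=> x; rewrite /Icode /= !in_itv /= => /andP[cx xc]; apply/andP; split.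
  by apply: le_trans cx; rewrite divr_ge0// ltW.
by apply: (lt_le_trans xc); rewrite ler_pdivrMr// mul1r -natrX ler_nat.
Qed.

Let f (x : measurableTypeR R) : infinite_words m :=
  digits (if (0 <= x :> R) && (x < 1 :> R) then x else 0).

Let f_cylinder w : U01 `&` f @^-1` cylinder w = Icode w.
Proof.
have codeE x : 0 <= x < 1 -> cylinder w (digits x) <-> Icode w x.
  move=> x01; rewrite cylinder_digits//; case/andP: x01 => x0 _.
  rewrite /Icode /= in_itv /= ler_pdivrMr// ltr_pdivlMr// ![x * _]mulrC.
  rewrite -(@truncn_eq _ _ (code w)); last by rewrite mulr_ge0// ltW.
  by split=> /eqP.
apply/seteqP; split=> x.
  by move=> [] /=; rewrite in_itv /= /f => /[dup] x01 -> /codeE; exact.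
move=> Ix; have := sub_Icode Ix; rewrite /= /f in_itv /= => x01.
by rewrite x01; split=> //; exact/codeE.
Qed.

Let measurable_f : measurable_fun setT f.
Proof.
apply: (@measurability _ _ _ (infinite_words m) setT f (range (@cylinder 'I_M))) => //.
move=> _ [_ [w _ <-] <-]; rewrite setTI.
rewrite -(setUIDK (f @^-1` cylinder w) U01); apply: measurableU.
  by rewrite setIC f_cylinder; exact: measurable_itv.
have [c0|c0] := pselect (cylinder w (digits 0)).
  rewrite (_ : _ `\` _ = ~` U01).
    by apply: measurableC; exact: measurable_itv.
  apply/seteqP; split=> x /=; first by case.
  by rewrite /f /= in_itv /= => /negP/negbTE ->; split.
rewrite (_ : _ `\` _ = set0)//; apply/seteqP; split=> x //=.
by rewrite /f /= in_itv /= => -[] /[swap] /negP/negbTE ->.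
Qed.

Let unif : {measure set (measurableTypeR R) -> \bar R} :=
  mrestr lebesgue_measure (measurable_itv `[0, 1[ : measurable U01).

Definition digits_law : set (infinite_words m) -> \bar R := pushforward unif f.

Let law0 : digits_law set0 = 0%E.
Proof. by rewrite /digits_law /pushforward preimage_set0 measure0. Qed.

Let law_ge0 B : (0 <= digits_law B)%E.
Proof. exact: measure_ge0. Qed.

Let law_sigma_additive : semi_sigma_additive digits_law.
Proof. exact: (@measure_semi_sigma_additive _ _ _ (pushforward unif f)). Qed.

HB.instance Definition _ := isMeasure.Build _ _ _ digits_law
  law0 law_ge0 law_sigma_additive.

Let law_cylinder w : digits_law (cylinder w) = ((M%:R^-1) ^+ size w)%:E.
Proof.
rewrite /digits_law /pushforward /unif /= /mrestr setIC f_cylinder.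
rewrite lebesgue_measure_itv /= lte_fin ltr_pM2r ?invr_gt0//.
by rewrite ltr_nat ltnSn -EFinD -mulrBl -natrB// subSnn mul1r exprVn.
Qed.

Let law_setT : digits_law setT = 1%E.
Proof.
rewrite (_ : setT = cylinder [::]) ?law_cylinder//.
by apply/seteqP; split.
Qed.

HB.instance Definition _ := Measure_isProbability.Build _ _ _ digits_law law_setT.

Lemma uniform_bernoulli_exists :
  exists mu : probability (infinite_words m) R, uniform_bernoulli mu.
Proof. by exists digits_law; exact: law_cylinder. Qed.

End uniform_bernoulli_exists.

Definition measure_number (R : realType) n m (mu : set (nat -> 'I_m) -> \bar R)
    (A : 'M[int]_n) (d : 'I_m -> 'cV[int]_n) : \bar R :=
  (\sum_(g \in nucleus A d) mu (path_language A d (nucleus A d) g))%E.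

(** ** Lebesgue measure on R^n *)

Section power_measure_step.
Context d (T : measurableType d) (R : realType).
Variables (m : {sigma_finite_measure set T -> \bar R}) (n : nat).
Variable mu : {sigma_finite_measure set (n.-tuple T) -> \bar R}.

Let tcons (p : T * n.-tuple T) : n.+1.-tuple T :=
  [the n.+1.-tuple _ of p.1 :: p.2].

Let measurable_tcons : measurable_fun setT tcons.
Proof. exact: measurable_cons. Qed.

Definition power_measure_step : set (n.+1.-tuple T) -> \bar R :=
  pushforward (m \x mu)%E tcons.

Let step0 : power_measure_step set0 = 0%E.
Proof. by rewrite /power_measure_step /pushforward preimage_set0 measure0. Qed.

Let step_ge0 B : (0 <= power_measure_step B)%E.
Proof. exact: measure_ge0. Qed.

Let step_sigma_additive : semi_sigma_additive power_measure_step.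
Proof.
exact: (@measure_semi_sigma_additive _ _ _ (pushforward (m \x mu)%E tcons)).
Qed.

HB.instance Definition _ := isMeasure.Build _ _ _ power_measure_step
  step0 step_ge0 step_sigma_additive.

Let step_sigma_finite : sigma_finite setT power_measure_step.
Proof.
have /sigma_finiteP[F [TF ndF Foo]] := sigma_finiteT m.
have /sigma_finiteP[G [TG ndG Goo]] := sigma_finiteT mu.
pose uncons (t : n.+1.-tuple T) : T * n.-tuple T :=
  (thead t, [tuple of behead t]).
have muncons : measurable_fun setT uncons.
  apply/measurable_fun_pairP; split; first exact: measurable_tnth.
  exact: measurable_behead.
have consK p : uncons (tcons p) = p.
  by case: p => x t; congr pair; apply/val_inj.
exists (fun k => uncons @^-1` (F k `*` G k)) => [|k].
  rewrite -preimage_bigcup (_ : \bigcup_k _ = setT) ?preimage_setT//.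
  apply/seteqP; split=> // -[x y] _.
  have [i _ Fix] : (\bigcup_i F i) x by rewrite -TF.
  have [j _ Gjy] : (\bigcup_i G i) y by rewrite -TG.
  exists (maxn i j) => //; split.
  - by move: x Fix; exact/subsetPset/ndF/leq_maxl.
  - by move: y Gjy; exact/subsetPset/ndG/leq_maxr.
have [[mF Fkoo] [mG Gkoo]] := (Foo k, Goo k); split.
  by rewrite -[X in measurable X]setTI; apply: muncons => //; exact: measurableX.
rewrite /power_measure_step /pushforward -comp_preimage.
rewrite (_ : _ \o _ = id); last by apply/funext => p; exact: consK.
by rewrite preimage_id product_measure1E// lte_mul_pinfty// ge0_fin_numE.
Qed.

HB.instance Definition _ := Measure_isSigmaFinite.Build _ _ _
  power_measure_step step_sigma_finite.

End power_measure_step.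

Fixpoint power_measure d (T : measurableType d) (R : realType)
    (m : {sigma_finite_measure set T -> \bar R}) n :
    {sigma_finite_measure set (n.-tuple T) -> \bar R} :=
  if n is n'.+1 then power_measure_step m (power_measure m n')
  else dirac ([tuple] : 0.-tuple T).

(* The n-fold product of [lebesgue_measure], carried over to column vectors;
   its value on boxes is given by [power_measure_box]. *)
Definition lebesgue_cV (R : realType) n (S : set 'cV[R]_n) : \bar R :=
  power_measure lebesgue_measure n [set t | S (\col_i tnth t i)].

Lemma power_measure_box d (T : measurableType d) (R : realType)
    (m : {sigma_finite_measure set T -> \bar R}) n (B : 'I_n -> set T) :
  (forall i, measurable (B i)) ->
  power_measure m n [set t | forall i, B i (tnth t i)] = (\prod_i m (B i))%E.
Proof.
elim: n B => [|n IHn] B mB /=.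
  by rewrite big_ord0 diracE mem_set// => -[].
rewrite big_ord_recl -IHn// /power_measure_step /pushforward.
rewrite -product_measure1E//.
  congr (product_measure1 _ _ _); apply/seteqP; split=> -[x t] /=.
    move=> Bt; split; first exact: (Bt ord0).
    by move=> i; have := Bt (lift ord0 i); rewrite tnthS.
  move=> [Bx Bt] i; have [j ->|->//] := unliftP ord0 i.
  by rewrite tnthS; exact: Bt.
rewrite (_ : [set _ | _] = \bigcap_(i in setT) ((@tnth n T)^~ i @^-1` B (lift ord0 i))).
  apply: fin_bigcap_measurable => // i _.
  by rewrite -[X in measurable X]setTI; exact: measurable_tnth.
by apply/seteqP; split=> t /= H i => [_|]; exact: H.
Qed.

(* Main.v *)
(* Every letter sequence z has a point X(z), the sum of the A^-k d(z_(k-1)) over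
   k >= 1, and T is the set of these points.  A bounded left-infinite path
   labelled by z and ending in g exists if and only if X(z) - g lies in T, and
   the vertices of such a path lie in the nucleus; hence meas(N) is the sum over
   all g in Z^n of mu{z | X(z) - g in T}.  More generally let rho(E) be the sum
   over g of mu{z | X(z) - g in E}.  As the law of X is self-affine and D is a
   transversal, m rho(E) = rho(A E), so the Z^n-invariance of rho propagates to
   the dense group of all A^-k g.  Since rho(]0, 1]^n) = 1, rho is Lebesgue
   measure. *)
From HB Require Import structures.
Require Import Defs.
From mathcomp Require Import all_boot all_order all_algebra complex.
From mathcomp Require Import all_classical all_reals all_analysis.
From mathcomp Require Import measurable_realfun zify ring lra.
Import Order.TTheory GRing.Theory Num.Theory.
Import numFieldNormedType.Exports.
Local Open Scope classical_set_scope.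
Local Open Scope ring_scope.

Set Implicit Arguments.
Unset Strict Implicit.
Unset Printing Implicit Defensive.

(** The eigenvalue condition does not make [A^-1] a contraction for the sup norm. What is extracted
    from it is summability: Cayley-Hamilton over [R[i]] bounds the sums of the moduli of the entries
    of all [A^-k]. This gives convergence of X(z), uniform bounds, and a rigidity principle: a
    bounded sequence with [D k.+1 = A D k] starts at 0. Rigidity is what identifies a point or a
    path with an expansion: the difference of two candidates is such a sequence.

    Translates of T by integer vectors may overlap, and a point may have several expansions.
    Measuring sets of words separately for each g counts these coincidences with their multiplicity,
    so that rho is additive and becomes a genuine measure on R^n, which can be compared with
    Lebesgue measure. *)

(** * Summability of the inverse powers of an expanding matrix *)

Lemma le_affine_recursion (F : numFieldType) (q C : F) (S : nat -> F) :
  0 <= q -> q < 1 -> 0 <= C -> S 0%N <= C / (1 - q) ->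
  (forall N, S N.+1 <= C + q * S N) -> forall N, S N <= C / (1 - q).
Proof.
move=> q0 q1 C0 S0 SS; elim=> // N IHN; apply: le_trans (SS N) _.
have q1' : 1 - q != 0 by rewrite subr_eq0 gt_eqF.
apply: (@le_trans _ _ (C + q * (C / (1 - q)))).
  by rewrite lerD2l ler_wpM2l.
rewrite le_eqVlt; apply/orP; left; apply/eqP; field.
exact: q1'.
Qed.

(* One factor [A - z] at a time: if [(A - z) Q] has summable iterates under
   [A^-1], the relation [A^-k Q = z^-1 (A^-(k-1) Q - A^-k (A - z) Q)] and
   [|z| > 1] make those of [Q] summable. *)
Lemma summable_iterates_annihilated (F : numFieldType) n (A Q : 'M[F]_n)
    (s : seq F) : A \in unitmx -> all (fun z => 1 < `|z|) s ->
  foldl (fun Q z => (A - z%:M) *m Q) Q s = 0 ->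
  forall i j, exists2 K : F, 0 <= K &
    forall N, \sum_(k < N) `|(iter k (mulmx (invmx A)) Q) i j| <= K.
Proof.
move=> uA; elim: s Q => [|z s IHs] Q /=.
  move=> _ -> i j; exists 0 => // N; rewrite big1// => k _.
  rewrite (_ : iter _ _ _ = 0) ?mxE ?normr0//.
  by elim: (k : nat) => //= l ->; rewrite mulmx0.
move=> /andP[z1 s1] Q0 i j.
have [K K0 KN] := IHs _ s1 Q0 i j.
set B := invmx A in KN *; set a := fun k => `|iter k (mulmx B) Q i j|.
set c := fun k => `|iter k (mulmx B) ((A - z%:M) *m Q) i j|.
have z0 : 0 < `|z| by apply: lt_trans z1.
have rec k : a k.+1 <= `|z|^-1 * (a k + c k.+1).
  rewrite -ler_pdivrMl ?invr_gt0// invrK.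
  rewrite /a /c -normrM.
  have -> : z * iter k.+1 (mulmx B) Q i j =
     iter k (mulmx B) Q i j - iter k.+1 (mulmx B) ((A - z%:M) *m Q) i j.
    have -> : iter k (mulmx B) Q = iter k.+1 (mulmx B) (A *m Q).
      by rewrite iterSr mulmxA mulVmx// mul1mx.
    rewrite mulmxBl; set X := A *m Q; rewrite mul_scalar_mx.
    have -> : iter k.+1 (mulmx B) (X - z *: Q) =
        iter k.+1 (mulmx B) X - z *: iter k.+1 (mulmx B) Q.
      by elim: k.+1 => //= l ->; rewrite mulmxBr -scalemxAr.
    by rewrite !mxE opprB addrCA subrr addr0.
  exact: ler_normB.
have q1 : `|z|^-1 < 1 by rewrite invf_lt1.
have q0 : 0 <= `|z|^-1 by rewrite invr_ge0.
(* Summing [rec] bounds the partial sums S of [a] by [S N.+1 <= C + |z|^-1 * S N]: the term of index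
   0 and the contribution of [c] make up [C]. The bound sought is the fixed point of this
   recursion. *)
set C := a 0%N + `|z|^-1 * K.
have a0 k : 0 <= a k by exact: normr_ge0.
have C0 : 0 <= C by rewrite addr_ge0// mulr_ge0.
have qq : 0 < 1 - `|z|^-1 by rewrite subr_gt0.
exists (C / (1 - `|z|^-1)); first by rewrite divr_ge0// ltW.
apply: (le_affine_recursion q0 q1 C0).
  by rewrite big_ord0 divr_ge0// ltW.
move=> N; rewrite big_ord_recl /= -/(a 0%N) /C -addrA lerD2l.
rewrite (eq_bigr (fun k : 'I_N => a k.+1)) //.
apply: le_trans (ler_sum _ (fun (k : 'I_N) _ => rec k)) _.
rewrite -mulr_sumr big_split /= mulrDr [leLHS]addrC lerD2r ler_wpM2l//.
apply: le_trans (KN N.+1); rewrite big_ord_recl /= -[leLHS]add0r lerD//.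
Qed.

Lemma char_poly_foldl (F : comNzRingType) n (A : 'M[F]_n.+1) (s : seq F) p :
  foldl (fun Q z => (A - z%:M) *m Q) (horner_mx A p) s =
  horner_mx A (p * \prod_(z <- s) ('X - z%:P)).
Proof.
elim: s p => [|z s IHs] p /=; first by rewrite big_nil mulr1.
rewrite big_cons mulrA -IHs; congr foldl.
by rewrite mulrC rmorphM rmorphB /= horner_mx_X horner_mx_C.
Qed.

(** Over the algebraically closed [R[i]] the characteristic polynomial splits, its roots are
    eigenvalues, and Cayley-Hamilton kills the product of the factors. *)
Lemma horner_mx_char_poly_expanding (R : realType) n (A : 'M[int]_n.+1) :
  expanding R A -> exists2 s : seq R[i], all (fun z => 1 < `|z|) s &
    foldl (fun Q z => (map_mx intr A - z%:M) *m Q) 1%:M s = 0.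
Proof.
move=> eA; set AC := map_mx intr A : 'M[R[i]]_n.+1.
have [s sE] := closed_field_poly_normal (char_poly AC).
rewrite (monicP (char_poly_monic _)) scale1r in sE.
exists s.
  apply/allP => z zs; apply: eA; rewrite eigenvalue_root_char sE.
  by rewrite root_prod_XsubC.
by rewrite -[1%:M](rmorph1 (horner_mx AC)) char_poly_foldl mul1r -sE Cayley_Hamilton.
Qed.

Lemma map_mx_intr_unitmx (F : numFieldType) n (A : 'M[int]_n) :
  \det A != 0 -> map_mx intr A \in @unitmx F n.
Proof. by move=> d0; rewrite unitmxE unitfE det_map_mx intr_eq0. Qed.

Lemma iter_mulmxE (F : pzRingType) n p (B : 'M[F]_n) (v : 'M[F]_(n, p)) k :
  iter k (mulmx B) v = iter k (mulmx B) 1%:M *m v.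
Proof. by elim: k => /= [|k ->]; rewrite ?mul1mx// mulmxA. Qed.

Lemma summable_inverse_powers (R : realType) n (A : 'M[int]_n) :
  expanding R A -> \det A != 0 -> exists2 K : R, 0 <= K &
    forall i j N, \sum_(k < N)
      `|(iter k (mulmx (invmx (map_mx intr A))) 1%:M : 'M[R]_n) i j| <= K.
Proof.
case: n A => [|n] A eA dA; first by exists 0 => // -[].
have [s s1 s0] := horner_mx_char_poly_expanding eA.
set B := invmx (map_mx intr A).
suff H i j : exists2 K : R, 0 <= K & forall N, \sum_(k < N)
    `|(iter k (mulmx B) 1%:M : 'M[R]_n.+1) i j| <= K.
  have /choice[K KP] : forall ij : 'I_n.+1 * 'I_n.+1, exists K : R, 0 <= K /\
      forall N, \sum_(k < N) `|(iter k (mulmx B) 1%:M : 'M[R]_n.+1) ij.1 ij.2| <= K.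
    by move=> [i j]; have [K] := H i j; exists K.
  exists (\sum_ij K ij); first by apply: sumr_ge0 => ij _; have [] := KP ij.
  move=> i j N; rewrite (bigD1 (i, j)) //=; have [K0 KN] := KP (i, j).
  rewrite -[leLHS]addr0 lerD ?KN//; apply: sumr_ge0 => ij _.
  by have [] := KP ij.
have [K K0 KN] := summable_iterates_annihilated
  (map_mx_intr_unitmx R[i] dA) s1 s0 i j.
(* The bound [K] is a nonnegative element of [R[i]]; inequalities there compare real parts, which
   brings the estimate back to [R]. *)
exists (complex.Re K); first by case: K K0 {KN} => a b; rewrite lecE => /andP[].
move=> N; suff : (\sum_(k < N) `|(iter k (mulmx B) 1%:M) i j|)%:C%C <= K.
  by case: K {K0 KN} => a b; rewrite lecE => /andP[].
apply: le_trans (KN N); rewrite le_eqVlt; apply/orP; left; apply/eqP.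
rewrite rmorph_sum; apply: eq_bigr => k _ /=.
have -> : iter k (mulmx (invmx (map_mx intr A))) 1%:M =
   map_mx (real_complex R) (iter k (mulmx B) 1%:M).
  elim: (k : nat) => [|l IHl] /=; first by rewrite map_scalar_mx.
  rewrite map_mxM -IHl /B map_invmx -map_mx_comp; congr (invmx _ *m _).
  by apply/matrixP => a b; rewrite !mxE /= rmorph_int.
by rewrite mxE normc_def /= expr0n addr0 sqrtr_sqr.
Qed.

(** The vector may change with [k], and [K] is independent of the sequence: one estimate then serves
    digit sequences, bounded orbits and fractional parts. *)
Lemma summable_inverse_orbit (R : realType) n (A : 'M[int]_n) :
  expanding R A -> \det A != 0 -> exists2 K : R, 0 <= K &
    forall M (v : nat -> 'cV[R]_n), (forall k i, `|v k i 0| <= M) ->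
    forall N i, \sum_(k < N)
      `|(iter k (mulmx (invmx (map_mx intr A))) (v k)) i 0| <= K * M.
Proof.
move=> eA dA; have [K K0 KP] := summable_inverse_powers eA dA.
exists (n%:R * K); first by rewrite mulr_ge0.
move=> M v vM N i; set B := invmx _.
apply: (@le_trans _ _ (\sum_(k < N) \sum_j
    `|(iter k (mulmx B) 1%:M : 'M[R]_n) i j| * M)).
  apply: ler_sum => k _; rewrite iter_mulmxE mxE.
  apply: le_trans (ler_norm_sum _ _ _) _; apply: ler_sum => j _.
  by rewrite normrM ler_wpM2l.
rewrite exchange_big /= -mulrA mulr_natl -[X in _ *+ X]card_ord -sumr_const.
apply: ler_sum => j _; rewrite -mulr_suml ler_wpM2r ?KP//.
by apply: le_trans (vM 0%N j).
Qed.

Lemma map_intr_inj (F : numFieldType) n p :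
  injective (map_mx intr : 'M[int]_(n, p) -> 'M[F]_(n, p)).
Proof.
move=> g h /matrixP gh; apply/matrixP => i j.
by have := gh i j; rewrite !mxE => /intr_inj.
Qed.

Lemma mulmx_int_inj n (A : 'M[int]_n) : \det A != 0 ->
  injective (mulmx A : 'cV[int]_n -> 'cV[int]_n).
Proof.
move=> dA g h /(congr1 (map_mx intr : _ -> 'cV[rat]_n)); rewrite !map_mxM.
move=> /(congr1 (mulmx (invmx (map_mx intr A)))).
by rewrite !mulKmx ?map_mx_intr_unitmx// => /map_intr_inj.
Qed.

(** * Expansions in base A *)

Section digit_expansions.
Variables (R : realType) (n m : nat) (A : 'M[int]_n) (d : 'I_m -> 'cV[int]_n).
Hypotheses (A_expanding : expanding R A) (detA : \det A != 0).

Local Notation AR := (map_mx intr A : 'M[R]_n).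
Local Notation B := (invmx AR).
Local Notation "v %:v" := (map_mx intr v : 'cV[R]_n) (at level 2, format "v %:v").
Implicit Types (z : nat -> 'I_m) (u v : 'cV[R]_n) (g h : 'cV[int]_n).

Lemma mulAK u : B *m (AR *m u) = u.
Proof. by rewrite mulKmx// map_mx_intr_unitmx. Qed.

Lemma mulBK u : AR *m (B *m u) = u.
Proof. by rewrite mulKVmx// map_mx_intr_unitmx. Qed.

Lemma iter_mulBD k u v :
  iter k (mulmx B) (u + v) = iter k (mulmx B) u + iter k (mulmx B) v.
Proof. by elim: k => //= k ->; rewrite mulmxDr. Qed.

Lemma iter_mulBA k v : iter k (mulmx B) (iter k (mulmx AR) v) = v.
Proof. by elim: k v => // k IHk v; rewrite iterSr/= mulAK IHk. Qed.

(* [D 0 = A^-k (D k)] for all [k], and these have bounded sums. *)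
Lemma bounded_orbit_eq0 (D : nat -> 'cV[R]_n) M :
  (forall k, AR *m D k = D k.+1) -> (forall k i, `|D k i 0| <= M) -> D 0%N = 0.
Proof.
move=> DS DM; have [K K0 KP] := summable_inverse_orbit A_expanding detA.
apply/matrixP => i j; rewrite ord1 mxE {j}; apply/eqP; apply: contrapT => /negP.
rewrite -normr_gt0 => Di; have H N := KP M D DM N i.
have DE k : iter k (mulmx B) (D k) = D 0%N.
  elim: k => // k IHk; rewrite iterSr -DS mulAK; exact: IHk.
have := H (Num.truncn (K * M / `|D 0%N i 0|)).+1.
under eq_bigr do rewrite DE.
rewrite sumr_const card_ord -mulr_natl -ler_pdivlMr// leNgt => /negP; apply.
by rewrite truncnS_gt.
Qed.

(* [A^-k] of the fractional part of [A^k t] must become small. *)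
Lemma inverse_lattice_dense (t : 'cV[R]_n) (e : R) : 0 < e ->
  exists k g, forall i, `|t i 0 - iter k (mulmx B) g%:v i 0| <= e.
Proof.
move=> e0; have [K K0 KP] := summable_inverse_orbit A_expanding detA.
pose f k : 'cV[int]_n := \col_i Num.floor (iter k (mulmx AR) t i 0).
pose v k := iter k (mulmx AR) t - (f k)%:v.
have v1 k i : `|v k i 0| <= 1.
  rewrite !mxE; set x := fun_of_matrix (iter _ _ _) _ _.
  have /andP[x1 x2] := floor_itv x; rewrite intrD1 in x2.
  by rewrite ger0_norm ?subr_ge0// lerBlDl ltW.
have vE k : iter k (mulmx B) (v k) = t - iter k (mulmx B) (f k)%:v.
  apply/eqP; rewrite eq_sym subr_eq -iter_mulBD /v subrK.
  by rewrite iter_mulBA.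
have := fun N i => KP 1 v v1 N i; rewrite mulr1 => H.
(* If no [k] worked, each [k] would contribute more than [e] to the sum over all coordinates,
   whereas summability bounds the total over [k < N] by [n K] for every [N]. *)
apply: contrapT => /forallNP noK.
have big k : e < \sum_i `|iter k (mulmx B) (v k) i 0|.
  have /forallNP/(_ (f k)) := noK k => /existsNP[i /negP]; rewrite -ltNge => ei.
  rewrite (bigD1 i)//= vE ![in X in _ < X + _]mxE.
  apply: lt_le_trans ei _; rewrite lerDl; exact: sumr_ge0.
pose N := (Num.truncn (n%:R * K / e)).+1.
suff : N%:R * e <= n%:R * K by rewrite -ler_pdivlMr// leNgt truncnS_gt.
apply: (@le_trans _ _ (\sum_(k < N) \sum_i `|iter k (mulmx B) (v k) i 0|)).
  rewrite mulr_natl -[X in _ *+ X]card_ord -sumr_const.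
  by apply: ler_sum => k _; exact: ltW.
rewrite exchange_big /= mulr_natl -[X in _ *+ X]card_ord -sumr_const.
by apply: ler_sum => i _; exact: H.
Qed.

Definition partial_point z N : 'cV[R]_n :=
  \sum_(k < N) iter k.+1 (mulmx B) (d (z k))%:v.

Lemma partial_pointS z N : partial_point z N.+1 =
  B *m ((d (z 0%N))%:v + partial_point (z \o succn) N).
Proof.
rewrite /partial_point big_ord_recl /= mulmxDr mulmx_sumr.
by congr (_ + _); apply: eq_bigr.
Qed.

Definition tile_point z : 'cV[R]_n :=
  \col_i limn (fun N => partial_point z N i 0).

Lemma digit_boundP : exists2 M : R, 0 <= M &
  forall i j, `|(B *m (d i)%:v) j 0| <= M.
Proof.
exists (\sum_i \sum_j `|(B *m (d i)%:v) j 0|).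
  by apply: sumr_ge0 => i _; apply: sumr_ge0.
move=> i j; rewrite (bigD1 i)//= (bigD1 j)//= -addrA lerDl addr_ge0//.
  exact: sumr_ge0.
by apply: sumr_ge0 => k _; exact: sumr_ge0.
Qed.

Lemma summable_digits : exists2 C : R, 0 <= C & forall z N i,
  \sum_(k < N) `|iter k.+1 (mulmx B) (d (z k))%:v i 0| <= C.
Proof.
have [K K0 KP] := summable_inverse_orbit A_expanding detA.
have [M M0 MP] := digit_boundP.
exists (K * M); first exact: mulr_ge0.
move=> z N i; apply: le_trans (KP M (fun k => B *m (d (z k))%:v) _ N i) => //.
by apply: ler_sum => k _; rewrite iterSr.
Qed.

Lemma partial_point_cvg z i :
  (fun N => partial_point z N i 0) @ \oo --> tile_point z i 0.
Proof.
rewrite mxE; have [C C0 CP] := summable_digits.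
have -> : (fun N => partial_point z N i 0) =
    series (fun k => iter k.+1 (mulmx B) (d (z k))%:v i 0).
  by apply/funext => N; rewrite seriesEord/= summxE.
apply: normed_cvg; apply: nondecreasing_is_cvgn.
  by apply/nondecreasing_seqP => N; rewrite [leRHS]seriesSr lerDl normr_ge0.
by exists C => _ [N _ <-]; rewrite /normed_series_of seriesEord/=; exact: CP.
Qed.

Arguments partial_point_cvg : clear implicits.

Lemma tile_point_bounded : exists2 C : R, 0 <= C &
  forall z i, `|tile_point z i 0| <= C.
Proof.
have [C C0 CP] := summable_digits; exists C => // z i.
have cz := partial_point_cvg z i.
suff /(_ _ cz) : forall l, partial_point z N i 0 @[N --> \oo] --> l ->
  `[- C, C]%classic l by rewrite /= in_itv /= -ler_norml.
apply: closed_cvg; first exact: itv_closed.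
apply: nearW => N; rewrite /= in_itv /= -ler_norml summxE.
by apply: le_trans (ler_norm_sum _ _ _) _; exact: CP.
Qed.

(** The one-letter recursion of the partial sums passes to the limit, each coordinate being a finite
    linear combination of convergent sequences. It turns the shift of words into an affine map. *)
Lemma tile_point_rec z :
  AR *m tile_point z = (d (z 0%N))%:v + tile_point (z \o succn).
Proof.
rewrite -[RHS]mulBK; congr mulmx; apply/matrixP => i j; rewrite ord1 {j}.
have cz := partial_point_cvg z i.
have H : partial_point z N i 0 @[N --> \oo] -->
    (B *m ((d (z 0%N))%:v + tile_point (z \o succn))) i 0.
  rewrite -cvg_shiftS /=.
  have -> : (fun N => partial_point z N.+1 i 0) = (fun N =>
      \sum_j B i j * ((d (z 0%N))%:v j 0 + partial_point (z \o succn) N j 0)).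
    apply/funext => N; rewrite partial_pointS mxE.
    by apply: eq_bigr => j _; rewrite [in LHS]mxE.
  rewrite mxE; apply: cvg_big => [|j _]; first exact: add_continuous.
  apply: cvgM; first exact: cvg_cst.
  have -> : ((d (z 0%N))%:v + tile_point (z \o succn)) j 0 =
    (d (z 0%N))%:v j 0 + tile_point (z \o succn) j 0 by rewrite mxE.
  by apply: cvgD; [exact: cvg_cst|exact: partial_point_cvg].
exact: (cvg_unique _ cz H).
Qed.

End digit_expansions.

Lemma finite_bounded_int (R : realType) n (M : R) :
  finite_set [set g : 'cV[int]_n | forall i, `|(g i 0)%:~R| <= M :> R].
Proof.
pose L := (Num.truncn M).+1.
pose f (a : {ffun 'I_n -> 'I_(L + L).+1}) : 'cV[int]_n :=
  \col_i ((a i : nat)%:Z - L%:Z).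
apply: (@sub_finite_set _ _ (range f)); last exact/finite_image/finite_finset.
move=> g gM; exists [ffun i => inord `|g i 0 + L%:Z|] => //.
apply/matrixP => i j; rewrite !mxE ord1 ffunE {j}.
have : `|g i 0| < L%:Z.
  rewrite -(ltr_int R) intr_norm (le_lt_trans (gM i))//.
  exact: truncnS_gt.
move=> gL; rewrite inordK; last by lia.
by lia.
Qed.

(** * Contraction of the action and finiteness of the nucleus *)

Section nucleus_of_expanding_action.
Variables (R : realType) (n m : nat) (A : 'M[int]_n) (d : 'I_m -> 'cV[int]_n).
Hypotheses (A_expanding : expanding R A) (detA : \det A != 0).
Hypothesis d_transversal : coset_transversal A d.

Local Notation AR := (map_mx intr A : 'M[R]_n).
Local Notation B := (invmx AR).
Local Notation "v %:v" := (map_mx intr v : 'cV[R]_n) (at level 2, format "v %:v").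
Implicit Types (z : nat -> 'I_m) (u v : 'cV[R]_n) (g h : 'cV[int]_n).

Lemma restr_letterP g i :
  A *m restr_letter A d g i = g + d i - d (act_letter A d g i).
Proof.
have [j [jP _]] := d_transversal (g + d i).
rewrite /restr_letter /virtual_endo; set g' := RHS.
apply: (@xgetPex _ 0 [set u | A *m u = g']); rewrite /g'.
by rewrite /act_letter; case: xgetP => [k -> [u _ uE]|/(_ j)//]; exists u.
Qed.

(** Uniqueness in the transversal forces [d j] to be the digit chosen by the action; injectivity of
    [A] then determines the restriction. *)
Lemma restr_letter_eq g i j h :
  A *m h = g + d i - d j -> restr_letter A d g i = h.
Proof.
move=> hE; apply: (mulmx_int_inj detA); rewrite restr_letterP hE.
congr (_ - d _); have [k [_ kP]] := d_transversal (g + d i).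
rewrite -(kP j); last by exists h.
rewrite -(kP (act_letter A d g i))//; exists (restr_letter A d g i) => //.
by rewrite restr_letterP.
Qed.

Lemma iter_mulB_cvg0 v i : iter k (mulmx B) v i 0 @[k --> \oo] --> (0 : R).
Proof.
have [K K0 KP] := summable_inverse_orbit A_expanding detA.
apply: cvg_series_cvg_0; apply: normed_cvg; apply: nondecreasing_is_cvgn.
  by apply/nondecreasing_seqP => N; rewrite [leRHS]seriesSr lerDl normr_ge0.
exists (K * \sum_i `|v i 0|) => _ [N _ <-].
rewrite /normed_series_of seriesEord/=; apply: (KP _ (fun=> v)) => _ j.
by rewrite (bigD1 j)//= lerDl sumr_ge0.
Qed.

(** Each letter read replaces g by [A^-1 (g + d_i - d_j)], so [c k] is a difference of two digits.
    The most recent letter carries the lowest power of [A^-1]. *)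
Lemma restr_word_expansion (M : R) w g :
  (forall i j, `|(B *m (d i)%:v) j 0| <= M) ->
  exists2 c : nat -> 'cV[R]_n, forall k i, `|(B *m c k) i 0| <= M + M &
    (restr_word A d g w)%:v =
      iter (size w) (mulmx B) g%:v + \sum_(k < size w) iter k.+1 (mulmx B) (c k).
Proof.
move=> MP; elim/last_ind: w => [|w i [c cM cE]].
  exists (fun=> 0) => [k i|]; last by rewrite big_ord0 addr0.
  (* The transversal supplies an index, hence [0 <= M]. *)
  have [j _] := d_transversal 0; have M0 := le_trans (normr_ge0 _) (MP j i).
  by rewrite mulmx0 mxE normr0 addr_ge0.
pose j := act_letter A d (restr_word A d g w) i.
exists (fun k => if k is k'.+1 then c k' else (d i)%:v - (d j)%:v).
  move=> [|k] l //=; rewrite mulmxBr mxE [in X in _ + X]mxE.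
  by apply: le_trans (ler_normB _ _) _; rewrite lerD.
rewrite size_rcons big_ord_recl /= /restr_word foldl_rcons -/(restr_word _ _ _ _).
rewrite -[LHS](mulAK detA) -map_mxM restr_letterP -/j.
rewrite map_mxB map_mxD cE -addrA addrAC !mulmxDr mulmx_sumr -!addrA; congr (_ + _).
Qed.

Lemma exists_contracting_set : exists N, contracting_set A d N.
Proof.
have [K K0 KP] := summable_inverse_orbit A_expanding detA.
have [M M0 MP] := digit_boundP R A d.
(* The 1 absorbs [A^-k g], which tends to 0; [K * (M + M)] bounds the accumulated digit differences,
   independently of g and of the word. *)
exists [set g : 'cV[int]_n | forall i, `|(g i 0)%:~R| <= 1 + K * (M + M) :> R].
split; first exact: finite_bounded_int.
move=> g.
have [k0 _ k0P] : \forall k \near \oo, forall i, `|iter k (mulmx B) g%:v i 0| <= 1.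
  apply: filter_forall => i.
  by apply: (cvgr0_norm_le _ (@iter_mulB_cvg0 g%:v i)); exact: ltr01.
exists k0 => w kw i; have [c cM cE] := restr_word_expansion w g MP.
have := congr1 (fun v : 'cV_n => v i 0) cE; rewrite mxE => ->.
rewrite mxE; apply: le_trans (ler_normD _ _) _; apply: lerD; first exact: k0P.
rewrite summxE; apply: le_trans (ler_norm_sum _ _ _) _.
apply: le_trans (KP _ (fun k => B *m c k) cM (size w) i).
by apply: ler_sum => k _; rewrite iterSr.
Qed.

Lemma finite_nucleus : finite_set (nucleus A d).
Proof. by case: (nucleus_contracting exists_contracting_set). Qed.

(** Paths run towards index 0, so the labels are read in decreasing order of index; hence [rev]. *)
Lemma restr_word_path z (h : nat -> 'cV[int]_n) :
  (forall k, restr_letter A d (h k.+1) (z k) = h k) ->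
  forall k l, restr_word A d (h (k + l)%N) (rev (mkseq (fun i => z (k + i)%N) l)) = h k.
Proof.
move=> hP k; elim=> [|l IHl]; first by rewrite addn0.
by rewrite mkseqS rev_rcons /= addnS hP.
Qed.

Lemma bounded_path_nucleus (M : R) z (h : nat -> 'cV[int]_n) :
  (forall k i, `|(h k i 0)%:~R| <= M) ->
  (forall k, restr_letter A d (h k.+1) (z k) = h k) ->
  forall k, nucleus A d (h k).
Proof.
move=> hM hP k N [[finN cN] _].
have /choice[f fP] := cN.
pose H := [set h : 'cV[int]_n | forall i, `|(h i 0)%:~R| <= M].
have [s sE] : exists s : seq 'cV[int]_n, H = [set` s].
  exact/finite_seqP/finite_bounded_int.
(* A bounded path visits only the finite set [H]. As [L] exceeds the waiting time of every vector of
   [H], starting [L] steps before [h k] forces [h k] into the given contracting set. *)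
pose L := \max_(g <- s) f g.
rewrite -(restr_word_path hP k L); apply: fP.
rewrite size_rev size_mkseq; apply: leq_bigmax_seq => //.
have : H (h (k + L)%N) by move=> i; exact: hM.
by rewrite sE.
Qed.

End nucleus_of_expanding_action.

Lemma le_cV_norm (R : realType) n (v : 'cV[R]_n) i : `|v i 0| <= `|v|.
Proof.
rewrite [leRHS]mx_normrE.
exact: (le_bigmax _ (fun ij : 'I_n * 'I_1 => `|v ij.1 ij.2|) (i, 0)).
Qed.

Lemma cV_norm_le (R : realType) n (v : 'cV[R]_n) (e : R) : 0 <= e ->
  (forall i, `|v i 0| <= e) -> `|v| <= e.
Proof.
move=> e0 ve; rewrite [leLHS]mx_normrE; apply: bigmax_le => // -[i j] _ /=.
by rewrite ord1.
Qed.

Lemma cvg_cV (R : realType) n (u : nat -> 'cV[R]_n) (v : 'cV[R]_n) :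
  (forall i, u k i 0 @[k --> \oo] --> v i 0) -> u k @[k --> \oo] --> v.
Proof.
move=> uv; apply/cvgrPdist_le => e e0.
have : \forall k \near \oo, forall i, `|v i 0 - u k i 0| <= e.
  apply: filter_forall => i; have /cvgrPdist_le := uv i; exact.
apply: filterS => k H; apply: cV_norm_le; first exact: ltW.
by move=> i; have := H i; rewrite !mxE.
Qed.

(** * Points of the tile and paths in the nucleus *)

Section tile_points.
Variables (R : realType) (n m : nat) (A : 'M[int]_n) (d : 'I_m -> 'cV[int]_n).
Variable T : set 'cV[R]_n.
Hypotheses (A_expanding : expanding R A) (detA : \det A != 0).
Hypothesis d_transversal : coset_transversal A d.
Hypothesis T_tile : self_affine_tile A d T.

Local Notation AR := (map_mx intr A : 'M[R]_n).
Local Notation B := (invmx AR).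
Local Notation "v %:v" := (map_mx intr v : 'cV[R]_n) (at level 2, format "v %:v").
Local Notation tile_point := (tile_point R A d).
Implicit Types (z : nat -> 'I_m) (g h : 'cV[int]_n) (t : 'cV[R]_n).

Lemma tile_bounded : exists M : R, forall t i, T t -> `|t i 0| <= M.
Proof.
have [_ /compact_bounded[M [_ TM]] _] := T_tile.
exists (M + 1) => t i Tt; apply: le_trans (le_cV_norm _ _) _.
by apply: TM => //; rewrite ltrDl.
Qed.

Lemma tile_step t : T t -> exists it : 'I_m * 'cV[R]_n,
  T it.2 /\ AR *m t = it.2 + (d it.1)%:v.
Proof.
have [_ _ TE] := T_tile => Tt.
have : [set AR *m t | t in T] (AR *m t) by exists t.
by rewrite TE => -[i _ [t' Tt' E]]; exists (i, t').
Qed.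

Lemma tile_contract i t : T t -> T (B *m ((d i)%:v + t)).
Proof.
have [_ _ TE] := T_tile => Tt.
have : (\bigcup_(i : 'I_m) [set t + (d i)%:v | t in T]) (t + (d i)%:v).
  by exists i => //; exists t.
by rewrite -TE => -[t' Tt' /esym E]; rewrite addrC E mulAK.
Qed.

(** The inverse branches [t |-> A^-1 (d_i + t)] preserve T. Applied along [z] to a fixed [t0] in T,
    they give points of T that converge to X(z), because [A^-N t0] tends to 0. *)
Lemma tile_point_mem z : T (tile_point z).
Proof.
have [[t0 Tt0] cT _] := T_tile.
have H N : forall z, T (partial_point R A d z N + iter N (mulmx B) t0).
  elim: N => [|N IHN] {}z; first by rewrite /partial_point big_ord0 add0r.
  by rewrite partial_pointS /= -mulmxDr -addrA; exact: tile_contract.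
have cT' : closed T by apply: compact_closed => //; exact: norm_hausdorff.
suff : partial_point R A d z N + iter N (mulmx B) t0 @[N --> \oo] --> tile_point z.
  by apply: (closed_cvg _ cT'); apply: nearW => N; exact: H.
apply: cvg_cV => i; rewrite -[tile_point z i 0]addr0.
under eq_fun do rewrite mxE.
by apply: cvgD; [exact: partial_point_cvg|exact: iter_mulB_cvg0].
Qed.

(** Digits are split off repeatedly, with remainders [s k] in T. The remainder minus the expansion
    of the shifted word is multiplied by [A] at each step and stays bounded, so it vanishes. *)
Lemma tile_pointE t : T t -> exists z, t = tile_point z.
Proof.
move=> Tt; have [it0 _] := tile_step Tt.
have /choice[F FP] : forall t, exists it : 'I_m * 'cV[R]_n,
    T t -> T it.2 /\ AR *m t = it.2 + (d it.1)%:v.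
  move=> s; have [/tile_step[it itP]|nT] := pselect (T s); first by exists it.
  (* An arbitrary value outside T makes the digit choice a total function that can be iterated; the
     orbit of [t] never leaves T. *)
  by exists it0.
pose s k := iter k (fun t => (F t).2) t; pose z k := (F (s k)).1.
have sT k : T (s k) by elim: k => //= k /FP[].
exists z; apply/eqP; rewrite -subr_eq0; apply/eqP.
pose D k := s k - tile_point (fun j => z (k + j)%N).
have [M TM] := tile_bounded.
apply: (@bounded_orbit_eq0 _ _ _ A_expanding detA D (M + M)).
  move=> k; rewrite /D mulmxBr tile_point_rec// addn0.
  have [_ ->] := FP _ (sT k); rewrite opprD addrA addrK; congr (_ - tile_point _).
  by apply/funext => j /=; rewrite addnS.
move=> k i; rewrite /D mxE [in X in _ + X]mxE.
apply: le_trans (ler_normB _ _) _.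
by apply: lerD; apply: TM => //; exact: tile_point_mem.
Qed.

Lemma path_language_tile g z :
  path_language A d (nucleus A d) g z -> T (tile_point z - g%:v).
Proof.
move=> [h [h0 hN hP]].
have [C C0 CP] := tile_point_bounded d A_expanding detA.
(* The output labels of the path: [A h_k = h_(k+1) + d(z_k) - d(w_k)]. They turn out to be the
   digits of X(z) - g. *)
pose w k := act_letter A d (h k.+1) (z k).
suff -> : tile_point z - g%:v = tile_point w by exact: tile_point_mem.
have [M MP] : exists M : R, forall g i, nucleus A d g -> `|(g i 0)%:~R| <= M.
  have [s sE] : exists s : seq 'cV[int]_n, nucleus A d = [set` s].
    exact/finite_seqP/(finite_nucleus A_expanding).
  exists (\sum_(g <- s) \sum_i `|(g i 0)%:~R|) => g' i; rewrite sE /= => gs.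
  rewrite (big_rem g')//= (bigD1 i)//= -addrA lerDl addr_ge0 ?sumr_ge0// => j _.
  exact: sumr_ge0.
apply/eqP; rewrite -subr_eq0; apply/eqP.
pose D k := tile_point (fun j => z (k + j)%N) - (h k)%:v - tile_point (fun j => w (k + j)%N).
rewrite -h0.
apply: (@bounded_orbit_eq0 _ _ _ A_expanding detA D (C + M + C)).
  move=> k; rewrite /D !mulmxBr !tile_point_rec// !addn0.
  have hE : A *m h k = h k.+1 + d (z k) - d (w k) by rewrite -hP restr_letterP.
  rewrite -map_mxM hE map_mxB map_mxD.
  have sh (x : nat -> 'I_m) : (fun j => x (k + j)%N) \o succn = (fun j => x (k.+1 + j)%N).
    by apply/funext => j /=; rewrite addnS.
  rewrite !sh; apply/matrixP => i j; rewrite !mxE; ring.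
move=> k i; rewrite /D mxE [in X in _ + X]mxE.
apply: le_trans (ler_normB _ _) _; apply: lerD => //.
rewrite mxE [in X in _ + X]mxE; apply: le_trans (ler_normB _ _) _; apply: lerD => //.
by rewrite mxE; exact: MP.
Qed.

Lemma tile_path g z : T (tile_point z - g%:v) ->
  nucleus A d g /\ path_language A d (nucleus A d) g z.
Proof.
move=> /tile_pointE[w wE].
(* The edge equation is solved for the earlier vertex, so that all vertices are integral. By [hE]
   each vertex is a difference of two expansions, which bounds the path. *)
pose h := fix h k := if k is k'.+1 then A *m h k' - d (z k') + d (w k') else g.
have hE k : (h k)%:v = tile_point (fun j => z (k + j)%N) - tile_point (fun j => w (k + j)%N).
  elim: k => [|k IHk]; first by rewrite -wE opprB addrC subrK.
  have sh (x : nat -> 'I_m) : (fun j => x (k.+1 + j)%N) = (fun j => x (k + j)%N) \o succn.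
    by apply/funext => j /=; rewrite addnS.
  rewrite !sh -[h k.+1]/(A *m h k - d (z k) + d (w k)) map_mxD map_mxB map_mxM.
  rewrite IHk mulmxBr !tile_point_rec// !addn0.
  by apply/matrixP => i j; rewrite !mxE; ring.
have [C C0 CP] := tile_point_bounded d A_expanding detA.
have hP k : restr_letter A d (h k.+1) (z k) = h k.
  apply: (restr_letter_eq detA d_transversal (j := w k)) => /=.
  by rewrite [RHS]addrAC addrK subrK.
have hM k i : `|(h k i 0)%:~R| <= C + C :> R.
  have := congr1 (fun v : 'cV_n => v i 0) (hE k); rewrite mxE => ->.
  rewrite mxE [in X in _ + X]mxE; apply: le_trans (ler_normB _ _) _; exact: lerD.
have hN k : nucleus A d (h k) by exact: (bounded_path_nucleus hM hP).
by split; [exact: (hN 0%N)|exists h].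
Qed.

End tile_points.

(** * Shift-compatibility of the Bernoulli measure *)

Section infinite_words.
Variable m : nat.
Implicit Types (w : seq 'I_m.+1) (i : 'I_m.+1).

Definition word_shift (z : infinite_words m) : infinite_words m := z \o succn.

Lemma measurable_cylinder w : measurable (cylinder w : set (infinite_words m)).
Proof. by apply: sub_sigma_algebra; exists w. Qed.

Lemma cylinder_cons i w (z : infinite_words m) :
  cylinder (i :: w) z <-> z 0%N = i /\ cylinder w (word_shift z).
Proof.
have E : mkseq z (size w).+1 = z 0%N :: mkseq (word_shift z) (size w).
  by rewrite /mkseq /= -[1%N]addn0 iotaDl -map_comp.
by rewrite /cylinder /= E; split=> [[-> ->]|[-> ->]].
Qed.

Lemma cylinder1 i : cylinder [:: i] = [set z | z 0%N = i].
Proof. by apply/seteqP; split=> z /= => [[]|<-]. Qed.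

Lemma cylinder_nil : cylinder [::] = [set: infinite_words m].
Proof. by apply/seteqP; split. Qed.

Lemma measurable_word_shift : measurable_fun [set: infinite_words m] word_shift.
Proof.
apply: (@measurability _ _ _ (infinite_words m) _ _
  (range (@cylinder 'I_m.+1))) => //.
move=> _ [_ [w _ <-] <-]; rewrite setTI.
rewrite (_ : _ @^-1` _ = \bigcup_(i in [set: 'I_m.+1]) cylinder (i :: w)).
  by apply: fin_bigcup_measurable => // i _; exact: measurable_cylinder.
apply/seteqP; split=> z.
  by move=> zw; exists (z 0%N) => //; apply/cylinder_cons.
by move=> [i _ /cylinder_cons[]].
Qed.

Lemma measurable_letter k i : measurable [set z : infinite_words m | z k = i].
Proof.
elim: k => [|k IHk]; first by rewrite -cylinder1; exact: measurable_cylinder.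
by have := measurable_word_shift measurableT IHk; rewrite setTI.
Qed.

Lemma measurable_fun_letter d (Y : measurableType d) k (f : 'I_m.+1 -> Y) :
  measurable_fun [set: infinite_words m] (fun z => f (z k)).
Proof.
move=> _ S mS; rewrite setTI.
rewrite (_ : _ @^-1` _ = \bigcup_(i in [set i | S (f i)]) [set z | z k = i]).
  by apply: fin_bigcup_measurable => // i _; exact: measurable_letter.
by apply/seteqP; split=> z /= => [Sz|[i /= Si zi]]; [exists (z k)|rewrite zi].
Qed.

(** Two cylinders are nested or disjoint; adjoining [set0] makes the family stable under
    intersection. *)
Definition cylinders : set (set (infinite_words m)) :=
  set0 |` range (@cylinder 'I_m.+1).

Lemma cylinders_setI : setI_closed cylinders.
Proof.
move=> C D [->|[w _ <-]]; first by rewrite set0I; left.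
move=> [->|[v _ <-]]; first by rewrite setI0; left.
wlog wv : v w / (size w <= size v)%N.
  by move=> H; have [/H//|/ltnW/H] := leqP (size w) (size v); rewrite setIC.
have tE (z : nat -> 'I_m.+1) : mkseq z (size w) = take (size w) (mkseq z (size v)).
  by rewrite /mkseq -map_take take_iota (minn_idPl wv).
have [vw|vw] := eqVneq (take (size w) v) w.
  right; exists v => //; apply/seteqP; split=> [z zv|z []//]; split=> //.
  by rewrite /cylinder/= tE zv.
left; apply/seteqP; split=> // z [zw zv]; apply: (negP vw).
by rewrite -[X in take _ X]zv -tE zw.
Qed.

Lemma sigma_cylinders : @measurable _ (infinite_words m) = <<s cylinders >>.
Proof.
apply/seteqP; split.
  apply: smallest_sub; first exact: smallest_sigma_algebra.
  by move=> C wC; apply: sub_sigma_algebra; right.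
apply: smallest_sub; first exact: smallest_sigma_algebra.
by move=> C [->|[w _ <-]]; [exact: measurable0|exact: measurable_cylinder].
Qed.

Variables (R : realType) (mu : probability (infinite_words m) R).
Hypothesis mu_uniform : uniform_bernoulli mu.

(** As functions of [S], both sides are finite measures, and they agree on cylinders, where the left
    side prepends one letter. *)
Lemma bernoulli_shift i (S : set (infinite_words m)) : measurable S ->
  mu ([set z | z 0%N = i] `&` word_shift @^-1` S) = ((m.+1%:R^-1)%:E * mu S)%E.
Proof.
move=> mS; have c0 : 0 <= m.+1%:R^-1 :> R by rewrite invr_ge0.
pose c := NngNum c0.
pose mi := mrestr mu (measurable_letter 0 i).
pose m1 := pushforward mi word_shift : {measure set (infinite_words m) -> \bar R}.
have := @measure_unique _ _ _ cylinders (fun=> setT) sigma_cylinders cylinders_setI _ _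
  (m1 measurable_word_shift) (mscale c mu) _ _ S mS.
rewrite /m1 /mi /= /pushforward /mrestr /mscale /= => mE.
rewrite setIC; apply: mE.
- by move=> _; right; exists [::] => //; exact: cylinder_nil.
- by apply/seteqP; split=> // z _; exists 0%N.
- move=> _ [->|[w _ <-]]; first by rewrite preimage_set0 set0I !measure0 mule0.
  rewrite mu_uniform -EFinM -exprS -[RHS](mu_uniform (i :: w)) setIC; congr (mu _).
  by apply/seteqP; split=> z /cylinder_cons.
- move=> _; rewrite preimage_setT setTI.
  by apply: le_lt_trans (probability_le1 mu _) (ltry _); exact: measurable_letter.
Qed.

End infinite_words.

(** Cauchy's functional equation: nonnegativity makes [f] monotone. If k is the integer part of
    [N x], then [N f(x)] and [N x f(1)] both lie between [k f(1)] and [(k + 1) f(1)], for every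
    N. *)
Lemma additive_nonneg_linear (R : realType) (f : R -> R) :
  (forall x, 0 <= x -> 0 <= f x) ->
  (forall x y, 0 <= x -> 0 <= y -> f (x + y) = f x + f y) ->
  forall x, 0 <= x -> f x = x * f 1.
Proof.
move=> f0 fD.
have fM k x : 0 <= x -> f (k%:R * x) = k%:R * f x.
  move=> x0; elim: k => [|k IHk].
    rewrite !mul0r; have := fD 0 0 (lexx _) (lexx _); rewrite addr0 => /eqP.
    by rewrite -subr_eq subrr => /eqP.
  by rewrite -addn1 natrD !mulrDl !mul1r fD ?IHk// mulr_ge0.
have fle x y : 0 <= x -> x <= y -> f x <= f y.
  move=> x0 xy; rewrite -(subrK x y) fD ?subr_ge0// lerDr f0// subr_ge0//.
have fk k : f k%:R = k%:R * f 1 by rewrite -[in LHS](mulr1 k%:R) fM.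
move=> x x0; apply/eqP; rewrite -subr_eq0; apply: contrapT => /negP.
rewrite -normr_gt0 => e0; set e := `|_| in e0.
have f10 := f0 1 ler01.
pose N := (Num.truncn (f 1 / e)).+1.
have Ne : f 1 < N%:R * e by rewrite -ltr_pdivrMr//; exact: truncnS_gt.
have Nx0 : 0 <= N%:R * x by rewrite mulr_ge0.
have /andP[kx xk] := truncn_itv Nx0; set k := Num.truncn _ in kx xk.
have := fle _ _ (ler0n _ k) kx; have := fle _ _ Nx0 (ltW xk).
rewrite !fk fM// => h1 h2.
suff : N%:R * e <= f 1 by rewrite leNgt Ne.
have -> : N%:R * e = `|N%:R * f x - N%:R * x * f 1|.
  by rewrite /e -(normr_nat R N) -normrM (normr_nat R N) mulrBr mulrA.
have kx' : k%:R * f 1 <= N%:R * x * f 1 by rewrite ler_wpM2r.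
have xk' : N%:R * x * f 1 <= k.+1%:R * f 1 by rewrite ler_wpM2r// ltW.
by move: h1 xk'; rewrite -natr1 mulrDl mul1r => h1 xk'; rewrite ler_norml; lra.
Qed.

(** * Uniqueness of Lebesgue measure under a dense group of translations *)

Section boxes.
Variables (R : realType) (n : nat).
Implicit Types (a b l t : 'I_n -> R) (i : 'I_n).

Local Notation Rn := (n.-tuple (measurableTypeR R)).

(** Half-open sides let a box be cut into two disjoint boxes, and let the integer translates of the
    unit cube partition space. *)
Definition box a b : set Rn :=
  [set x | forall i, `]a i, b i]%classic (tnth x i : R)].

Lemma measurable_box a b : measurable (box a b).
Proof.
rewrite (_ : box a b = \bigcap_(i in setT)
    ((fun x : Rn => tnth x i) @^-1` `]a i, b i]%classic)).
  apply: fin_bigcap_measurable => // i _; rewrite -[X in measurable X]setTI.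
  exact: measurable_tnth.
by apply/seteqP; split=> x /= H i => [_|]; exact: H.
Qed.

Lemma box_empty a b i : b i <= a i -> box a b = set0.
Proof.
move=> ba; apply/seteqP; split=> // x /(_ i) /=; rewrite in_itv /= => /andP[h1 h2].
by have := lt_le_trans h1 (le_trans h2 ba); rewrite ltxx.
Qed.

Lemma box_sub a b a' b' : (forall i, a' i <= a i) -> (forall i, b i <= b' i) ->
  box a b `<=` box a' b'.
Proof.
move=> aa bb x H i; have := H i; rewrite /= !in_itv /= => /andP[h1 h2].
by rewrite (le_lt_trans (aa i) h1) (le_trans h2 (bb i)).
Qed.

Definition boxes : set (set Rn) := [set S | exists a b, S = box a b].

Lemma boxes_setI : setI_closed boxes.
Proof.
move=> _ _ [a [b ->]] [a' [b' ->]].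
exists (fun i => Num.max (a i) (a' i)), (fun i => Num.min (b i) (b' i)).
apply/seteqP; split=> x.
  move=> [h h'] i; have := h i; have := h' i; rewrite /= !in_itv /= gt_max le_min.
  by move=> /andP[h1 h2] /andP[h3 h4]; apply/andP; split; apply/andP.
by move=> h; split=> i; have := h i; rewrite /= !in_itv /= gt_max le_min =>
  /andP[/andP[h1 h2] /andP[h3 h4]]; apply/andP.
Qed.

Definition centered_cubes k : set Rn := box (fun=> - k.+1%:R) (fun=> k.+1%:R).

Lemma bound_tuple (x : Rn) : exists k, forall i, `|tnth x i : R| < k.+1%:R.
Proof.
exists (\max_i Num.truncn `|tnth x i : R|) => i.
apply: lt_le_trans (truncnS_gt _) _; rewrite ler_nat ltnS.
exact: (@leq_bigmax _ (fun i => Num.truncn `|tnth x i : R|) i).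
Qed.

Lemma centered_cubes_cover : \bigcup_k centered_cubes k = setT.
Proof.
apply/seteqP; split=> // x _; have [k xk] := bound_tuple x; exists k => // i.
by have := xk i; rewrite /= in_itv /= ltr_norml => /andP[-> /ltW].
Qed.

Lemma sigma_boxes : @measurable _ Rn = <<s boxes >>.
Proof.
apply/seteqP; split; last first.
  apply: smallest_sub; first exact: sigma_algebra_measurable.
  by move=> _ [a [b ->]]; exact: measurable_box.
pose U := g_sigma_algebraType boxes.
have : measurable_fun [set: U] (fun x : U => x : Rn).
  apply/measurable_fun_tnthP => i.
  apply: (@measurability _ _ _ (measurableTypeR R) _ _ (@ocitv R)) => //.
  move=> _ [_ [[u v] _ <-] <-]; rewrite setTI /=.
  (* A slab, constrained in coordinate [i] only, is exhausted by boxes that grow in the other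
     coordinates. *)
  rewrite (_ : _ @^-1` _ = \bigcup_k box (fun j => if j == i then u else - k.+1%:R)
                              (fun j => if j == i then v else k.+1%:R)).
    by apply: bigcupT_measurable => k; apply: sub_sigma_algebra; eexists; eexists.
  apply/seteqP; split=> x /=.
    move=> xi; have [k xk] := bound_tuple x; exists k => // j.
    have [->|_] := eqVneq j i; first exact: xi.
    by have := xk j; rewrite /= in_itv /= ltr_norml => /andP[-> /ltW].
  by move=> [k _ /(_ i)]; rewrite eqxx.
by move=> H S mS; have := H measurableT S mS; rewrite setTI.
Qed.

Section unique.
Variable nu : {measure set Rn -> \bar R}.
Hypothesis nu_unit : nu (box (fun=> 0) (fun=> 1)) = 1%E.
Hypothesis nu_fin : forall a b, (nu (box a b) < +oo)%E.
Hypothesis nu_inv : forall t (e : R), 0 < e -> exists2 c : 'I_n -> R,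
  (forall i, `|t i - c i| <= e) &
  forall a b, nu (box (fun i => a i + c i) (fun i => b i + c i)) = nu (box a b).

(* Only one inequality is proved, by squeezing a translate by a vector of the
   dense group between the box and its slight enlargements to the upper right;
   the other one follows by translating back. *)
Let nu_shift_le a b t :
  (nu (box a b) <= nu (box (fun i => a i + t i)%R (fun i => b i + t i)%R))%E.
Proof.
pose F k := box (fun i => a i + t i) (fun i => b i + t i + 2 * k.+1%:R^-1).
have FE : \bigcap_k F k = box (fun i => a i + t i) (fun i => b i + t i).
  apply/seteqP; split=> x; last first.
    by move=> + k _; apply: box_sub => // i; rewrite lerDl.
  move=> xF i; have := xF 0%N I i; rewrite /= !in_itv /= => /andP[-> _] /=.
  apply/ler_addgt0Pr => e e0.
  have e2 : 0 < e / 2 by rewrite divr_gt0.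
  have [k ke] : exists k, k.+1%:R^-1 <= e / 2.
    exists (Num.truncn (e / 2)^-1); rewrite -[leRHS]invrK lef_pV2 ?posrE ?invr_gt0//.
    by rewrite ltW// truncnS_gt.
  have := xF k I i; rewrite /= in_itv /= => /andP[_ xk].
  by apply: le_trans xk _; rewrite lerD2l mulrC -ler_pdivlMr.
have cF : nu \o F @ \oo --> nu (\bigcap_k F k).
  apply: nonincreasing_cvg_mu; first exact: nu_fin.
  - by move=> k; exact: measurable_box.
  - by rewrite FE; exact: measurable_box.
  - move=> k l kl; apply/subsetPset; apply: box_sub => // i.
    by rewrite lerD2l ler_pM2l// lef_pV2 ?posrE// ler_nat.
rewrite -FE; apply: (cvge_ge _ cF); apply: nearW => k /=.
have k0 : 0 < k.+1%:R^-1 :> R by rewrite invr_gt0.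
(* Aiming at [t + 1/(k+1)] with error at most [1/(k+1)] gives [t <= c <= t + 2/(k+1)] in each
   coordinate, so the translate by [c] lies in [F k]. *)
have [c ct <-] := nu_inv (fun i => t i + k.+1%:R^-1) k0.
rewrite le_measure ?inE//; try exact: measurable_box.
apply: box_sub => i; have := ct i; rewrite ler_norml; move: k0;
  by set e := _^-1 => k0 /andP[h1 h2]; lra.
Qed.

Lemma nu_shift a b t :
  nu (box (fun i => a i + t i) (fun i => b i + t i)) = nu (box a b).
Proof.
apply/eqP; rewrite eq_le nu_shift_le andbT.
have := nu_shift_le (fun i => a i + t i) (fun i => b i + t i) (fun i => - t i).
have tK (f : 'I_n -> R) : (fun i => f i + t i - t i) = f.
  by apply/funext => i; rewrite addrK.
by rewrite !tK.
Qed.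

Let V l : R := fine (nu (box (fun=> 0) l)).
Let upd l i (x : R) := fun j => if j == i then x else l j.

Let V_ge0 l : 0 <= V l. Proof. exact: fine_ge0. Qed.

(** A box with [i]-th side [x + y] is cut at height [x], and the upper piece is moved down by
    [nu_shift]; the volume is thus additive in that side. *)
Let V_linear l i x : 0 <= x -> V (upd l i x) = x * V (upd l i 1).
Proof.
apply: (additive_nonneg_linear (f := fun x => V (upd l i x))) => // {}x y x0 y0.
rewrite /V -fineD ?ge0_fin_numE//.
rewrite -(nu_shift (fun=> 0) (upd l i y) (upd (fun=> 0) i x)) -measureU.
- congr (fine (nu _)); apply/seteqP; split=> z.
    move=> zb; have := zb i; rewrite /= in_itv /= /upd eqxx => /andP[zi0 zi].
    have [zx|zx] := leP (tnth z i : R) x; [left|right] => j; have := zb j;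
      rewrite /= !in_itv /= /upd; have [->|ji] := eqVneq j i => //.
    + by move=> _; rewrite zi0 zx.
    + by move=> _; rewrite add0r zx addrC zi.
    + by rewrite !addr0.
  move=> [] zb j; have := zb j; rewrite /= !in_itv /= /upd; have [->|ji] := eqVneq j i => //.
  + by move=> /andP[-> h]; rewrite (le_trans h)// lerDl.
  + by rewrite add0r addrC => /andP[h ->]; rewrite (le_lt_trans x0 h).
  + by rewrite !addr0.
- exact: measurable_box.
- exact: measurable_box.
- apply/seteqP; split=> // z [/(_ i) + /(_ i)] /=.
  rewrite !in_itv /= /upd eqxx add0r => /andP[_ h1] /andP[h2 _].
  by move: h1; rewrite bnd_simp leNgt h2.
Qed.

Let V_prod l : (forall i, 0 <= l i) -> V l = \prod_i l i.
Proof.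
(* The sides listed in [s] are normalized to 1 one at a time, ending at the unit cube. *)
move=> l0; pose w (s : seq 'I_n) := fun j => if j \in s then 1 else l j.
suff H s : uniq s -> V l = \prod_(i <- s) l i * V (w s).
  rewrite (H (index_enum 'I_n)) ?index_enum_uniq//.
  rewrite (_ : w _ = fun=> 1); last by apply/funext => j; rewrite /w mem_index_enum.
  by rewrite /V nu_unit mulr1.
elim: s => [_|i s IHs /andP[nis us]].
  by rewrite big_nil mul1r; congr V; apply/funext.
rewrite big_cons (IHs us) [RHS]mulrAC [RHS]mulrC; congr (_ * _).
have -> : w s = upd (w s) i (l i).
  apply/funext => j; rewrite /upd; have [->|//] := eqVneq j i.
  by rewrite /w (negbTE nis).
rewrite V_linear//; congr (_ * V _); apply/funext => j.
by rewrite /upd /w inE; have [] := eqVneq j i.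
Qed.

Lemma lebesgue_unique_dense S : measurable S ->
  nu S = power_measure lebesgue_measure n S.
Proof.
apply: (@measure_unique _ _ _ boxes centered_cubes).
- exact: sigma_boxes.
- exact: boxes_setI.
- by move=> k; eexists; eexists.
- exact: centered_cubes_cover.
- move=> _ [a [b ->]].
  have [/existsP[i ba]|/existsPn ab] := boolP [exists i, b i <= a i].
    by rewrite (box_empty ba) !measure0.
  have mB i : measurable (`]a i, b i]%classic : set (measurableTypeR R)) by [].
  rewrite [RHS](power_measure_box lebesgue_measure mB).
  rewrite (eq_bigr (fun i => (b i - a i)%:E)); last first.
    by move=> i _ /=; rewrite lebesgue_measure_itv /= lte_fin ltNge ab.
  rewrite prodEFin -V_prod; last by move=> i; rewrite subr_ge0 ltW// ltNge.
  rewrite /V fineK ?ge0_fin_numE// -(nu_shift (fun=> 0) _ a).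
  by congr (nu (box _ _)); apply/funext => i; rewrite ?add0r ?subrK.
- by move=> k; exact: nu_fin.
Qed.

End unique.
End boxes.

(** * Transfer between columns, which carry topology, and tuples, which carry the sigma-algebra *)

Section column_tuples.
Variables (R : realType) (n : nat).
Local Notation Rn := (n.-tuple (measurableTypeR R)).

Definition col_of_tuple (t : Rn) : 'cV[R]_n := \col_i tnth t i.
Definition tuple_of_col (v : 'cV[R]_n) : Rn := [tuple v i 0 | i < n].

Lemma col_of_tupleK : cancel col_of_tuple tuple_of_col.
Proof. by move=> t; apply: eq_from_tnth => i; rewrite tnth_mktuple mxE. Qed.

Lemma tuple_of_colK : cancel tuple_of_col col_of_tuple.
Proof. by move=> v; apply/matrixP => i j; rewrite mxE tnth_mktuple ord1. Qed.

Lemma measurable_preimage_col d (W : measurableType d) (f : W -> 'cV[R]_n)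
    (E : set 'cV[R]_n) :
  (forall i, measurable_fun setT (fun w => f w i 0 : measurableTypeR R)) ->
  measurable (col_of_tuple @^-1` E) -> measurable (f @^-1` E).
Proof.
move=> mf mE; rewrite (_ : f @^-1` E = (tuple_of_col \o f) @^-1` (col_of_tuple @^-1` E)).
  rewrite -[X in measurable X]setTI.
  suff mtf : measurable_fun setT (tuple_of_col \o f) by exact: mtf.
  apply/measurable_fun_tnthP => i; rewrite (_ : _ \o _ = fun w => f w i 0) //.
  by apply/funext => w /=; rewrite tnth_mktuple.
by apply/seteqP; split=> w /=; rewrite tuple_of_colK.
Qed.

Lemma measurable_col_entry i :
  measurable_fun setT (fun t : Rn => col_of_tuple t i 0 : measurableTypeR R).
Proof.
rewrite (_ : (fun t : Rn => _) = fun t => tnth t i); first exact: measurable_tnth.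
by apply/funext => t; rewrite mxE.
Qed.

Lemma measurable_mulmx_preimage (B : 'M[R]_n) (u : 'cV[R]_n) (E : set 'cV[R]_n) :
  measurable (col_of_tuple @^-1` E) ->
  measurable (col_of_tuple @^-1` [set v | E (B *m v + u)]).
Proof.
move=> mE.
apply: (@measurable_preimage_col _ _ (fun t => B *m col_of_tuple t + u)) => // i.
rewrite (_ : (fun t : Rn => _) =
    fun t : Rn => (\sum_j B i j * col_of_tuple t j 0) + u i 0); last first.
  by apply/funext => t; rewrite mxE [X in X + _]mxE.
apply: measurable_funD; last exact: measurable_cst.
apply: measurable_sum => j; apply: measurable_funM; first exact: measurable_cst.
exact: measurable_col_entry.
Qed.

(** [U k] is the union of the cells of the grid of mesh [1/(k+1)] that meet T. It is a countable
    union of boxes, and closedness makes T the intersection of all [U k]. *)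
Lemma closed_measurable_col (T : set 'cV[R]_n) : closed T ->
  measurable (col_of_tuple @^-1` T).
Proof.
move=> cT.
pose c k (g : 'cV[int]_n) : set Rn := box (fun i => (g i 0)%:~R / k.+1%:R)
  (fun i => ((g i 0)%:~R + 1) / k.+1%:R).
pose U k := \bigcup_(g in [set g | exists2 t, T t & c k g (tuple_of_col t)]) c k g.
rewrite (_ : _ @^-1` _ = \bigcap_k U k).
  apply: bigcapT_measurable => k; rewrite /U bigcup_mkcond.
  apply: countable_bigcupT_measurable.
    exact: countableP.
  by move=> g; case: ifP => // _; exact: measurable_box.
have cubeP k (x : Rn) : exists g, c k g x.
  (* Cells are open on the left and closed on the right, hence the ceiling minus 1 and not the
     floor. *)
  exists (\col_i (Num.ceil (tnth x i * k.+1%:R : R) - 1)) => i.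
  rewrite /= in_itv /= mxE ler_pdivlMr// ltr_pdivrMr//.
  rewrite intrB subrK; have := ceil_itv (tnth x i * k.+1%:R : R).
  by rewrite intrB.
apply/seteqP; split=> [x Tx k _|x Ux].
  have [g gx] := cubeP k x; exists g => //.
  by exists (col_of_tuple x) => //; rewrite col_of_tupleK.
apply: cT => /= S /nbhs_ballP[e /= e0 eS].
pose k := Num.truncn e^-1.
have ke : k.+1%:R^-1 < e.
  by rewrite -[ltRHS]invrK ltf_pV2 ?posrE ?invr_gt0//; exact: truncnS_gt.
have [g [t Tt gt] gx] := Ux k I.
exists t; split=> //; apply: eS; rewrite -ball_normE /ball_ /=.
apply: le_lt_trans ke; apply: cV_norm_le => [|i]; first by rewrite invr_ge0.
have := gt i; have := gx i; rewrite /= !in_itv /= tnth_mktuple !mxE mulrDl mul1r.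
set y := _ / _; set e' := k.+1%:R^-1; move=> /andP[h1 h2] /andP[h3 h4].
by rewrite ler_norml; lra.
Qed.

End column_tuples.

Lemma exchange_esum (R : realType) (I J : choiceType) (a : I -> J -> \bar R) :
  (forall i j, 0 <= a i j)%E ->
  (\esum_(i in [set: I]) \esum_(j in [set: J]) a i j =
   \esum_(j in [set: J]) \esum_(i in [set: I]) a i j)%E.
Proof.
move=> a0; rewrite !esum_esum//.
rewrite (reindex_esum ([set: J] `*`` fun=> [set: I]) _ (fun p => (p.2, p.1)))//.
by split=> [//|[? ?] [? ?] _ _ /= [-> ->]//|[i j] _]; exists (j, i).
Qed.

Lemma esum_finite_support (R : realType) (I : choiceType) (S : set I) (a : I -> \bar R) :
  finite_set S -> (forall i, 0 <= a i)%E -> (forall i, ~ S i -> a i = 0%E) ->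
  (\esum_(i in [set: I]) a i = \sum_(i \in S) a i)%E.
Proof.
move=> finS a0 aS; rewrite -esum_fset// [RHS]esum_mkcond.
apply: eq_esum => i _; case: ifPn => // /negP iS; apply: aS => Si.
by apply: iS; rewrite inE.
Qed.

(** * The measure rho attached to a random vector *)

Section lattice_count.
Context {disp : measure_display} {W : measurableType disp}.
Variables (R : realType) (n : nat) (mu : probability W R) (X : W -> 'cV[R]_n).
Hypothesis measurable_X : forall i,
  measurable_fun setT (fun w => X w i 0 : measurableTypeR R).

Local Notation "v %:v" := (map_mx intr v : 'cV[R]_n) (at level 2, format "v %:v").
Local Notation Rn := (n.-tuple (measurableTypeR R)).
Implicit Types (g h : 'cV[int]_n) (E : set 'cV[R]_n) (S : set Rn).

(** The mean number of points of the random set [X - Z^n] that fall in [E]. *)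
Definition lattice_count E : \bar R :=
  (\esum_(g in [set: 'cV[int]_n]) mu [set w | E (X w - g%:v)%R])%E.

Lemma measurable_translate E u : measurable (@col_of_tuple R n @^-1` E) ->
  measurable [set w | E (X w - u)].
Proof.
move=> mE; rewrite (_ : [set w | _] = X @^-1` [set v | E (1%:M *m v - u)]).
  by apply: measurable_preimage_col => //; exact: measurable_mulmx_preimage.
by apply/seteqP; split=> w /=; rewrite mul1mx.
Qed.

Lemma lattice_count_translate E h :
  lattice_count [set v | E (v - h%:v)] = lattice_count E.
Proof.
rewrite /lattice_count [RHS](reindex_esum setT _ (fun g => g + h)).
  apply: eq_esum => g _; congr (mu _); apply/seteqP; split=> w /=;
  by rewrite map_mxD opprD addrA.
rewrite setTT_bijective; exists (fun g => g - h) => g.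
  by rewrite addrK.
by rewrite subrK.
Qed.

Definition tuple_count S : \bar R := lattice_count (@tuple_of_col R n @^-1` S).

Lemma tuple_countE E : tuple_count (@col_of_tuple R n @^-1` E) = lattice_count E.
Proof.
rewrite /tuple_count; congr lattice_count.
by apply/seteqP; split=> v /=; rewrite tuple_of_colK.
Qed.

Let col_tuple S : @col_of_tuple R n @^-1` (@tuple_of_col R n @^-1` S) = S.
Proof. by apply/seteqP; split=> v /=; rewrite col_of_tupleK. Qed.

Lemma measurable_translate_tuple S u : measurable S ->
  measurable [set w | S (tuple_of_col (X w - u))].
Proof.
move=> mS; apply: (measurable_translate (E := @tuple_of_col R n @^-1` S)).
by rewrite col_tuple.
Qed.

Let tuple_count0 : tuple_count set0 = 0%E.
Proof. by apply: esum1 => g _; rewrite -(measure0 mu); congr (mu _). Qed.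

Let tuple_count_ge0 S : (0 <= tuple_count S)%E.
Proof. by apply: esum_ge0 => g _; exact: measure_ge0. Qed.

Let tuple_count_sigma_additive : semi_sigma_additive tuple_count.
Proof.
move=> F mF tF mUF.
have -> : tuple_count (\bigcup_k F k) = (\sum_(0 <= k <oo) tuple_count (F k))%E.
  rewrite nneseries_esumT// exchange_esum//; apply: eq_esum => g _.
  rewrite -nneseries_esumT//.
  rewrite -(@measure_semi_bigcup _ _ _ mu
    (fun k => [set w | F k (tuple_of_col (X w - g%:v))])).
  - by congr (mu _); apply/seteqP; split=> w /=.
  - by move=> k; exact: measurable_translate_tuple.
  - apply/trivIsetP => i j _ _ ij; apply/seteqP; split=> // w [Fi Fj].
    move/trivIsetP: tF => /(_ i j I I ij) FF.
    suff : (F i `&` F j) (tuple_of_col (X w - g%:v)) by rewrite FF.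
    by split.
  - rewrite (_ : \bigcup_n _ = [set w | (\bigcup_k F k) (tuple_of_col (X w - g%:v))]).
      exact: measurable_translate_tuple.
    by apply/seteqP; split=> w.
by apply: is_cvg_nneseries => k _ _.
Qed.

HB.instance Definition _ := isMeasure.Build _ _ _ tuple_count
  tuple_count0 tuple_count_ge0 tuple_count_sigma_additive.

Variable C : R.
Hypothesis X_bounded : forall w i, `|X w i 0| <= C.

Let support (M : R) : set 'cV[int]_n :=
  [set g | forall i, `|(g i 0)%:~R| <= C + M :> R].

Let not_support M E g : (forall v i, E v -> `|v i 0| <= M) -> ~ support M g ->
  [set w | E (X w - g%:v)] = set0.
Proof.
move=> EM gM; apply/seteqP; split=> // w /= Ew; apply: gM => i.
have -> : (g i 0)%:~R = X w i 0 - (X w - g%:v) i 0 by rewrite !mxE; ring.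
by apply: le_trans (ler_normB _ _) _; apply: lerD => //; exact: EM.
Qed.

Lemma lattice_count_bounded M E : (forall v i, E v -> `|v i 0| <= M) ->
  lattice_count E = (\sum_(g \in support M) mu [set w | E (X w - g%:v)%R])%E.
Proof.
move=> EM; apply: esum_finite_support => [|g|g gM].
- exact: finite_bounded_int.
- exact: measure_ge0.
by rewrite (not_support EM gM) measure0.
Qed.

Let box_bounded (a b : 'I_n -> R) (v : 'cV[R]_n) i : box a b (tuple_of_col v) ->
  `|v i 0| <= \sum_j (`|a j| + `|b j|).
Proof.
move=> /(_ i); rewrite /= in_itv /= tnth_mktuple => /andP[h1 h2].
rewrite (bigD1 i)//= -[leLHS]addr0; apply: lerD; last first.
  by apply: sumr_ge0 => j _; exact: addr_ge0.
have := ler_norm (b i); have := ler_norm (- a i); rewrite normrN.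
have := normr_ge0 (a i); have := normr_ge0 (b i).
by move=> ? ? ? ?; rewrite ler_norml; apply/andP; split; lra.
Qed.

Lemma tuple_count_box_lty a b : (tuple_count (box a b) < +oo)%E.
Proof.
have bM v i := @box_bounded a b v i.
rewrite /tuple_count (lattice_count_bounded bM).
rewrite fsbig_finite//; last exact: finite_bounded_int.
apply: lte_sum_pinfty => g _; apply: le_lt_trans (ltry 1); apply: probability_le1.
by apply: measurable_translate_tuple; exact: measurable_box.
Qed.

(** Exactly one integer translate of X lands in the half-open cube, so the events indexed by g
    partition the probability space. *)
Lemma tuple_count_unit : tuple_count (box (fun=> 0) (fun=> 1)) = 1%E.
Proof.
have bM v i := @box_bounded (fun=> 0) (fun=> 1) v i.
rewrite /tuple_count (lattice_count_bounded bM); set M := \sum_(j < n) _.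
rewrite -measure_fin_bigcup//.
- rewrite -(probability_setT mu); congr (mu _); apply/seteqP; split=> // w _.
  pose g : 'cV[int]_n := \col_i (Num.ceil (X w i 0) - 1).
  have gw : box (fun=> 0) (fun=> 1) (tuple_of_col (X w - g%:v)).
    move=> i; rewrite /= in_itv /= tnth_mktuple !mxE.
    have := ceil_itv (X w i 0); rewrite !intrB => /andP[h1 h2].
    by apply/andP; split; lra.
  exists g => //; apply: contrapT => ng.
  have : [set w | box (fun=> 0) (fun=> 1) (tuple_of_col (X w - g%:v))] w by [].
  by rewrite (not_support bM ng).
- exact: finite_bounded_int.
- apply/trivIsetP => g h _ _; apply: contraNeq => /set0P[w [gw hw]].
  apply/eqP/matrixP => i j; rewrite ord1 {j}.
  have := gw i; have := hw i; rewrite /= !in_itv /= !tnth_mktuple !mxE.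
  move=> /andP[h1 h2] /andP[h3 h4].
  have k1 : (g i 0)%:~R < (h i 0)%:~R + 1 :> R by lra.
  have k2 : (h i 0)%:~R < (g i 0)%:~R + 1 :> R by lra.
  move: k1 k2; rewrite -!intrD1 !ltr_int !ltzD1 => k1 k2.
  by apply/eqP; rewrite eq_le k1 k2.
- by move=> g _; apply: measurable_translate_tuple; exact: measurable_box.
Qed.

Lemma lattice_count_lebesgue E :
  (forall (t : 'cV[R]_n) (e : R), 0 < e -> exists2 c : 'cV[R]_n,
    (forall i, `|t i 0 - c i 0| <= e) &
    forall E', measurable (@col_of_tuple R n @^-1` E') ->
      lattice_count [set v | E' (v - c)] = lattice_count E') ->
  measurable (@col_of_tuple R n @^-1` E) -> lattice_count E = lebesgue_cV E.
Proof.
move=> H mE; rewrite -tuple_countE /lebesgue_cV.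
rewrite -(lebesgue_unique_dense (nu := tuple_count))//.
- exact: tuple_count_unit.
- exact: tuple_count_box_lty.
- move=> t e e0; have [c tc cP] := H (\col_i t i) e e0.
  exists (fun i => c i 0) => [i|a b]; first by have := tc i; rewrite mxE.
  rewrite -[RHS](cP (@tuple_of_col R n @^-1` box a b)); last first.
    by rewrite col_tuple; exact: measurable_box.
  rewrite /tuple_count; congr lattice_count.
  apply/seteqP; split=> v /= vb i; have := vb i;
    rewrite /= !in_itv /= !tnth_mktuple !mxE => /andP[h1 h2];
    by apply/andP; split; lra.
Qed.

End lattice_count.

(** Cancels the factor m even where rho is infinite. *)
Lemma muleI_fin (R : realType) (r : R) : r != 0 -> injective (mule r%:E).
Proof.
move=> r0 x y E; rewrite -[x]mul1e -[y]mul1e -(mulVf r0) EFinM -!muleA.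
by congr (_ * _)%E.
Qed.

(** * Self-affinity of the law of X and translation invariance of rho *)

Section tile_point_law.
Variables (R : realType) (n m : nat) (A : 'M[int]_n) (d : 'I_m.+1 -> 'cV[int]_n).
Variable mu : probability (infinite_words m) R.
Hypotheses (A_expanding : expanding R A) (detA : \det A != 0).
Hypothesis d_transversal : coset_transversal A d.
Hypothesis mu_uniform : uniform_bernoulli mu.

Local Notation AR := (map_mx intr A : 'M[R]_n).
Local Notation B := (invmx AR).
Local Notation "v %:v" := (map_mx intr v : 'cV[R]_n) (at level 2, format "v %:v").
Local Notation X := (tile_point R A d : infinite_words m -> 'cV[R]_n).
Local Notation LC := (lattice_count mu X).
Local Notation mset E := (measurable (@col_of_tuple R n @^-1` E)).
Implicit Types (g h : 'cV[int]_n) (E : set 'cV[R]_n).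

Lemma measurable_tile_point i :
  measurable_fun setT (fun z => X z i 0 : measurableTypeR R).
Proof.
apply: (@measurable_fun_cvg _ (infinite_words m) R setT
    (fun N z => partial_point R A d z N i 0)) => [N|z _]; last first.
  exact: partial_point_cvg.
rewrite (_ : (fun z : infinite_words m => _) = fun z : infinite_words m =>
    \sum_(k < N) iter k.+1 (mulmx B) (d (z k))%:v i 0); last first.
  by apply/funext => z; rewrite summxE.
by apply: measurable_sum => k; exact: (measurable_fun_letter k
  (fun j => iter k.+1 (mulmx B) (d j)%:v i 0 : measurableTypeR R)).
Qed.

Lemma mset_mulmx E : mset E -> mset [set v | E (B *m v)].
Proof.
move=> mE; have := measurable_mulmx_preimage B 0 mE.
by under [X in _ @^-1` X]eq_set do rewrite addr0.
Qed.

(** Conditioning on the first letter: if it is [i], then [X(z) - g] equals [A^-1] applied to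
    [X(shift z) - (A g - d_i)], and the shifted word is again uniform and independent of [i]. *)
Lemma mu_tile_point E g : mset E ->
  (m.+1%:R%:E * mu [set z | E (X z - g%:v)%R] =
   \sum_(i \in [set: 'I_m.+1]) mu [set z | E (B *m (X z - (A *m g - d i)%:v))%R])%E.
Proof.
move=> mE; pose S i : set (infinite_words m) := [set z | E (B *m (X z - (A *m g - d i)%:v))].
have mS i : measurable (S i).
  apply: (measurable_translate measurable_tile_point (E := [set v | E (B *m v)])).
  exact: mset_mulmx.
have -> : [set z | E (X z - g%:v)] =
    \bigcup_(i in [set: 'I_m.+1]) ([set z | z 0%N = i] `&` @word_shift m @^-1` S i).
  have XE z : B *m (X (word_shift z) - (A *m g - d (z 0%N))%:v) = X z - g%:v.
    rewrite map_mxB map_mxM opprB addrA [X (word_shift z) + _]addrC.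
    by rewrite -tile_point_rec// -mulmxBr mulAK.
  apply/seteqP; split=> z /=.
    by move=> Ez; exists (z 0%N) => //; split=> //; rewrite /S /= XE.
  by move=> [i _ [<-]]; rewrite /S /= XE.
rewrite measure_fin_bigcup; last 3 first.
- exact: finite_finset.
- apply/trivIsetP => i j _ _ ij; apply/seteqP; split=> // z [[/= zi _] [zj _]].
  by move: ij; rewrite -zi -zj eqxx.
- move=> i _; apply: measurableI; first exact: measurable_letter.
  by rewrite -[X in measurable X]setTI; exact: (measurable_word_shift measurableT).
rewrite ge0_mule_fsumr; last by move=> i; exact: measure_ge0.
apply: eq_fsbigr => i _; transitivity (m.+1%:R%:E * ((m.+1%:R^-1)%:E * mu (S i)))%E.
  by congr (_ * _)%E; exact: bernoulli_shift.
by rewrite muleA -EFinM mulfV// mul1e.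
Qed.

(* [A g - d_i] runs through each vector of Z^n once. *)
Lemma lattice_count_mulmx E : mset E ->
  (m.+1%:R%:E * LC E = LC [set v | E (B *m v)%R])%E.
Proof.
move=> mE; have sumE (x : \bar R) : (m.+1%:R%:E * x = \sum_(i < m.+1) x)%E.
  by rewrite mule_natl sumr_const card_ord.
rewrite sumE.
rewrite /lattice_count -esum_sum; last by move=> *; exact: measure_ge0.
rewrite [RHS](reindex_esum ([set: 'cV[int]_n] `*`` fun=> [set: 'I_m.+1]) _
  (fun p => A *m p.1 - d p.2)).
  rewrite -(esum_esum (a := fun g i =>
    mu [set z | E (B *m (X z - (A *m g - d i)%:v))%R])); last first.
    by move=> *; exact: measure_ge0.
  apply: eq_esum => g _; rewrite -sumE mu_tile_point//.
  rewrite esum_fset//; exact: finite_finset.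
split=> // [[g i] [h j] _ _ /= E1|h _].
  have ij : i = j.
    have [k' [_ k'P]] := d_transversal (d i).
    rewrite -(k'P i); last by exists 0 => //; rewrite mulmx0 subrr.
    apply: k'P; exists (g - h) => //; rewrite mulmxBr.
    have -> : A *m g = A *m h - d j + d i by rewrite -E1 subrK.
    by apply/matrixP => a b; rewrite !mxE; ring.
  by move: E1; rewrite ij => /addIr /(mulmx_int_inj detA) ->.
(* Digits occur with a minus sign in [A g - d_i], so it is [- h] that is decomposed, as
   [A g + d_i]. *)
have [i [[g _ gE] _]] := d_transversal (- h).
by exists (- g, i) => //=; rewrite mulmxN gE opprB opprK addrAC subrr add0r.
Qed.

(** Translating [E] by [A^-(k+1) h] amounts to translating [A E] by [A^-k h]; the scaling relation
    has the same factor on both sides, and it cancels. *)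
Lemma lattice_count_inverse_lattice k h E : mset E ->
  LC [set v | E (v - iter k (mulmx B) h%:v)] = LC E.
Proof.
elim: k E => [|k IHk] E mE; first exact: lattice_count_translate.
have mE' : mset [set v | E (v - iter k.+1 (mulmx B) h%:v)].
  have := measurable_mulmx_preimage 1%:M (- iter k.+1 (mulmx B) h%:v) mE.
  by under [X in _ @^-1` X]eq_set do rewrite mul1mx.
have r0 : m.+1%:R != 0 :> R by [].
apply: (muleI_fin r0).
rewrite !lattice_count_mulmx//= -(IHk [set v | E (B *m v)]); last exact: mset_mulmx.
by congr lattice_count; apply/seteqP; split=> v /=; rewrite mulmxBr.
Qed.

Lemma lattice_count_tile_point E : mset E -> LC E = lebesgue_cV E.
Proof.
move=> mE; have [C C0 CP] := tile_point_bounded d A_expanding detA.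
apply: (lattice_count_lebesgue measurable_tile_point CP) => // t e e0.
have [k [h kh]] := inverse_lattice_dense A_expanding detA t e0.
by exists (iter k (mulmx B) h%:v) => // E' mE'; exact: lattice_count_inverse_lattice.
Qed.

End tile_point_law.

Unset Implicit Arguments.

Theorem corollary26 (R : realType) (n m : nat) (A : 'M[int]_n)
    (d : 'I_m.+1 -> 'cV[int]_n) (T : set 'cV[R]_n)
    (mu : probability (infinite_words m) R)
    (A_expanding : expanding R A)
    (card_X : `|\det A|%N = m.+1)
    (d_transversal : coset_transversal A d)
    (T_tile : self_affine_tile A d T)
    (mu_uniform : uniform_bernoulli mu) :
  lebesgue_cV T = measure_number mu A d.
Proof.
have detA : \det A != 0 by rewrite -absz_eq0 card_X.
have cT : closed T.
  by have [_ cT _] := T_tile; apply: compact_closed => //; exact: norm_hausdorff.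
rewrite -(lattice_count_tile_point A_expanding detA d_transversal mu_uniform); last first.
  exact: closed_measurable_col.
rewrite /lattice_count /measure_number.
rewrite (esum_finite_support (S := nucleus A d)).
- apply: eq_fsbigr => g /set_mem gN; congr (mu _); apply/seteqP; split=> z.
    by move=> /(tile_path A_expanding detA d_transversal T_tile)[].
  exact: (path_language_tile A_expanding detA d_transversal T_tile).
- exact: (finite_nucleus A_expanding detA d_transversal).
- by move=> g; exact: measure_ge0.
(* Outside the nucleus the event is empty: [X(z) - g] in T would give a bounded path ending in g. *)
- move=> g gN; rewrite (_ : [set _ | _] = set0) ?measure0//.
  apply/seteqP; split=> // z.
  by move=> /(tile_path A_expanding detA d_transversal T_tile)[].
Qed.
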